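(* Let $(M,g)$ be a Riemannian manifold. For a $(p,q)$ double form $\omega$ with $p,q\geq 0$ one has $$\mathrm{Weit}(\omega)=\omega\circ\Bigl(\frac{g^{p-1}\mathrm{Ric}}{(p-1)!}-2\,\frac{g^{p-2}R}{(p-2)!}\Bigr)-\frac14\,R\#\omega,$$ with the convention that a term containing a negative power of $g$ is zero.
   Context: A $(p,q)$ double form on $M$ is a smooth section of $\Lambda^pT^*M\otimes\Lambda^qT^*M$. Exterior product: $(\theta_1\otimes\theta_2).(\theta_3\otimes\theta_4)=(\theta_1\wedge\theta_3)\otimes(\theta_2\wedge\theta_4)$ (dot often omitted; powers $g^k$ for this product, $g^0=1$). Composition product: $(\theta_1\otimes\theta_2)\circ(\theta_3\otimes\theta_4)=\langle\theta_1,\theta_4\rangle\,\theta_3\otimes\theta_2$, extended bilinearly (zero if the degrees of $\theta_1,\theta_4$ differ). $\iota_{v\otimes1}$ is insertion of the vector $v$ in the first argument of the left factor. $R$ is the Riemann curvature tensor seen as a symmetric $(2,2)$ double form, with sign such that $R=\frac12g^2$ on the unit round sphere; $\mathrm{Ric}$ is the Ricci tensor, seen as a $(1,1)$ double form. With $(e_i)$ a local orthonormal frame, $D\omega=\sum_i(e^i\otimes1).\nabla_{e_i}\omega$ and $\delta\omega=-\sum_i\iota_{e_i\otimes1}\nabla_{e_i}\omega$. The operator $\mathrm{Weit}$ is the zeroth-order curvature term in the Weitzenböck formula $(D\delta+\delta D)\omega=\nabla^*\nabla\omega+\mathrm{Weit}(\omega)$; explicitly $$\mathrm{Weit}(\omega)=\sum_{i,j=1}^n\iota_{e_i\otimes1}\bigl((e^j\otimes1).R_{e_ie_j}\omega\bigr),\qquad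 R_{e_ie_j}\omega=\nabla^2_{e_j,e_i}\omega-\nabla^2_{e_i,e_j}\omega.$$ Sharp product: the Clifford product on $\Lambda V^*$ ($V=T_xM$) is the associative bilinear product determined, for $e\in V^*$ and $\alpha\in\Lambda^pV^*$, by $e\cdot\alpha=e\wedge\alpha-\iota_e\alpha$ and $\alpha\cdot e=(-1)^p(e\wedge\alpha+\iota_e\alpha)$. With $[\alpha,\beta]=\alpha\cdot\beta-\beta\cdot\alpha$, one sets $(\alpha_1\otimes\alpha_2)\#(\beta_1\otimes\beta_2)=[\alpha_1,\beta_1]\otimes[\alpha_2,\beta_2]$, extended bilinearly to double forms. *)

(* Defs.v *)
From HB Require Import structures.
From mathcomp Require Import all_boot all_order all_algebra.
From mathcomp Require Import boolp classical_sets functions reals.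
From mathcomp Require Import topology normedtype derive.
(* finset comes last so that its names prevail over those of classical_sets *)
From mathcomp Require Import ring finset.

Set Implicit Arguments.
Unset Strict Implicit.
Unset Printing Implicit Defensive.
Import GRing.Theory Num.Theory numFieldNormedType.Exports.
Local Open Scope ring_scope.

(* V is R^n with an arbitrary (in general not orthonormal) basis d_i and dual
   basis dx^i; the metric is the Gram matrix G i j = <d_i, d_j>.  Vectors and
   covectors are both row vectors of components, so that the musical
   isomorphisms are v |-> v *m G and a |-> a *m invmx G.
   A form al stands for \sum_I al I dx^I, where dx^I is dx^i1 /\ ... /\ dx^ip
   for I = {i1 < ... < ip}. *)
Notation eform R n := {ffun {set 'I_n} -> R^o}.

(* An element of the tensor square: \sum_(I, J) om (I, J) dx^I (x) dx^J. *)
Notation dform R n := {ffun {set 'I_n} * {set 'I_n} -> R^o}.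

Section ExteriorAlgebra.
Variables (R : realType) (n : nat).
Implicit Types (a v : 'rV[R]_n) (al be : eform R n) (I J : {set 'I_n}).
Implicit Types (G : 'M[R]_n).

Definition cobase (i : 'I_n) : 'rV[R]_n := delta_mx 0 i.

Definition ebase I : eform R n := [ffun J => (J == I)%:R].

Definition esgn (i : 'I_n) I : R := (-1) ^+ #|[set j in I | (j < i)%N]|.

(* a /\ al for a covector a *)
Definition covwedge a al : eform R n :=
  [ffun I : {set 'I_n} => \sum_(i in I) esgn i I * a 0 i * al (I :\ i)].

(* insertion of the vector v as first argument *)
Definition insertion v al : eform R n :=
  [ffun I : {set 'I_n} =>
    \sum_(i | i \notin I) esgn i I * v 0 i * al (i |: I)].

(* enum I lists I in increasing order *)
Definition ewedge al be : eform R n :=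
  \sum_I al I *: foldr (fun i => covwedge (cobase i)) be (enum I).

Definition covector a : eform R n := \sum_i a 0 i *: ebase [set i].

Definition homogeneous p al := forall I, al I != 0 -> #|I| = p.

Definition sharp G a : 'rV[R]_n := a *m invmx G.
Definition flat G v : 'rV[R]_n := v *m G.

(* <dx^I, be> is be evaluated on the vectors dual to dx^i1, ..., dx^ip, and the
   value of a form is obtained by inserting its arguments one after another.
   On dx^J it is the Gram determinant of the <dx^i, dx^j> if #|I| = #|J|, and
   0 otherwise. *)
Definition einner G al be : R :=
  \sum_I al I *
    foldl (fun x i => insertion (sharp G (cobase i)) x) be (enum I) set0.

Definition tens al be : dform R n := [ffun s => al s.1 * be s.2].

Definition bilin_ext
    (F : eform R n -> eform R n -> eform R n -> eform R n -> dform R n)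
    (A B : dform R n) : dform R n :=
  \sum_s \sum_t (A s * B t) *:
    F (ebase s.1) (ebase s.2) (ebase t.1) (ebase t.2).

Definition dfwedge : dform R n -> dform R n -> dform R n :=
  bilin_ext (fun x1 x2 y1 y2 => tens (ewedge x1 y1) (ewedge x2 y2)).

Definition dfcomp G : dform R n -> dform R n -> dform R n :=
  bilin_ext (fun x1 x2 y1 y2 => einner G x1 y2 *: tens y1 x2).

Definition on_left (f : eform R n -> eform R n) (A : dform R n) : dform R n :=
  \sum_s A s *: tens (f (ebase s.1)) (ebase s.2).

Definition on_right (f : eform R n -> eform R n) (A : dform R n) : dform R n :=
  \sum_s A s *: tens (ebase s.1) (f (ebase s.2)).

Definition dfone : dform R n := tens (ebase set0) (ebase set0).

Definition dfpow (A : dform R n) (k : nat) : dform R n := iter k (dfwedge A) dfone.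

Definition bihomogeneous p q (A : dform R n) :=
  forall s, A s != 0 -> #|s.1| = p /\ #|s.2| = q.

Record is_clifford G (m : eform R n -> eform R n -> eform R n) : Prop := {
  cliffDl : forall c al be ga, m (c *: al + be) ga = c *: m al ga + m be ga;
  cliffDr : forall c al be ga, m ga (c *: al + be) = c *: m ga al + m ga be;
  cliffA : forall al be ga, m al (m be ga) = m (m al be) ga;
  cliff_covl : forall a al,
    m (covector a) al = covwedge a al - insertion (sharp G a) al;
  cliff_covr : forall a p al, homogeneous p al ->
    m al (covector a) =
      (-1) ^+ p *: (covwedge a al + insertion (sharp G a) al) }.

(* See cliffordP below for the existence. *)
Definition clifford G : eform R n -> eform R n -> eform R n :=
  xget (fun _ _ => 0) [set m | is_clifford G m]%classic.

Definition ecomm G al be : eform R n := clifford G al be - clifford G be al.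

Definition dfsharp G : dform R n -> dform R n -> dform R n :=
  bilin_ext (fun x1 x2 y1 y2 => tens (ecomm G x1 y1) (ecomm G x2 y2)).

(* G itself as a (1,1) double form *)
Definition bilform G : dform R n :=
  \sum_i \sum_j G i j *: tens (ebase [set i]) (ebase [set j]).

(* g^(p-k) A / (p-k)!, read as 0 if the exponent is negative *)
Definition gpow_term G (p k : nat) (A : dform R n) : dform R n :=
  if (k <= p)%N then
    ((p - k)`!%:R)^-1 *: dfwedge (dfpow (bilform G) (p - k)) A
  else 0.

(* Pull-back of forms by a linear map with dy^j |-> \sum_i L i j dx^i *)
Definition epull (L : 'M[R]_n) al : eform R n :=
  \sum_I al I *:
    foldr (fun j => covwedge (row j L^T)) (ebase set0) (enum I).

Definition dfpull (L : 'M[R]_n) (A : dform R n) : dform R n :=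
  \sum_s A s *: tens (epull L (ebase s.1)) (epull L (ebase s.2)).

End ExteriorAlgebra.

Arguments cobase {R n} i.
Arguments dfone {R n}.

Local Open Scope classical_set_scope.

Section Charts.
Variables (R : realType) (n : nat).

Definition pderiv (i : 'I_n) (f : 'rV[R]_n -> R) : 'rV[R]_n -> R := 'D_(cobase i) f.

Fixpoint Ck (k : nat) (U : set 'rV[R]_n) (f : 'rV[R]_n -> R) : Prop :=
  (forall x, U x -> {for x, continuous f}) /\
  if k is k'.+1 then
    forall i, (forall x, U x -> derivable f x (cobase i)) /\ Ck k' U (pderiv i f)
  else True.

Definition smooth_on (U : set 'rV[R]_n) (f : 'rV[R]_n -> R) := forall k, Ck k U f.

Record manifold := Manifold {
  mcarrier :> topologicalType;
  m_hausdorff : hausdorff_space mcarrier;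
  m_second_countable : @second_countable mcarrier;
  chart : Type;
  chart_dom : chart -> set mcarrier;
  chart_map : chart -> mcarrier -> 'rV[R]_n;
  chart_inv : chart -> 'rV[R]_n -> mcarrier;
  chart_dom_open : forall c, open (chart_dom c);
  chart_img_open : forall c, open (chart_map c @` chart_dom c);
  chart_mapK : forall c x, chart_dom c x -> chart_inv c (chart_map c x) = x;
  chart_map_cont : forall c x, chart_dom c x ->
    {for x, continuous (chart_map c)};
  chart_inv_cont : forall c y, (chart_map c @` chart_dom c) y ->
    {for y, continuous (chart_inv c)};
  chart_cover : forall x, exists c, chart_dom c x;
  chart_trans_smooth : forall c d i,
    smooth_on (chart_map c @` (chart_dom c `&` chart_dom d))
      (fun y => chart_map d (chart_inv c y) 0 i) }.

Definition chart_img (M : manifold) (c : chart M) : set 'rV[R]_n :=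
  chart_map c @` chart_dom c.

Definition overlap (M : manifold) (c d : chart M) : set 'rV[R]_n :=
  chart_map c @` (chart_dom c `&` chart_dom d).

Definition transition (M : manifold) (c d : chart M) (y : 'rV[R]_n) : 'rV[R]_n :=
  chart_map d (chart_inv c y).

(* Tensor fields are families of components, one for each chart, related by the
   tensor transformation rule.  In MathComp-Analysis ('J f y) i j is the i-th
   partial derivative of the j-th component of f. *)
Record riemannian_metric (M : manifold) := Metric {
  gmx :> chart M -> 'rV[R]_n -> 'M[R]_n;
  gmx_smooth : forall c i j, smooth_on (chart_img c) (fun y => gmx c y i j);
  gmx_sym : forall c y, chart_img c y -> (gmx c y)^T = gmx c y;
  gmx_pos : forall c y, chart_img c y -> forall v : 'rV[R]_n, v != 0 ->
    0 < (v *m gmx c y *m v^T) 0 0;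
  gmx_trans : forall c d y, overlap c d y ->
    let L := 'J (transition c d) y in
    gmx c y = L *m gmx d (transition c d y) *m L^T }.

Record double_form (M : manifold) (p q : nat) := DoubleForm {
  dfc :> chart M -> 'rV[R]_n -> dform R n;
  dfc_smooth : forall c s, smooth_on (chart_img c) (fun y => dfc c y s);
  dfc_deg : forall c y, chart_img c y -> bihomogeneous p q (dfc c y);
  dfc_trans : forall c d y, overlap c d y ->
    dfc c y = dfpull ('J (transition c d) y) (dfc d (transition c d y)) }.

Section LeviCivita.
(* Gram matrix of the metric in the coordinates of a chart *)
Variable G : 'rV[R]_n -> 'M[R]_n.
Implicit Types (om : 'rV[R]_n -> dform R n) (x u v : 'rV[R]_n).

(* nabla_(d_i) d_j = \sum_m christoffel m i j d_m *)
Definition christoffel (m i j : 'I_n) (x : 'rV[R]_n) : R :=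
  2^-1 * \sum_k invmx (G x) m k *
    (pderiv i (fun y => G y k j) x + pderiv j (fun y => G y k i) x
     - pderiv k (fun y => G y i j) x).

(* The derivation of the exterior algebra with
   dx^j |-> nabla_(d_k) dx^j = - \sum_i christoffel j k i dx^i *)
Definition conn (k : 'I_n) (x : 'rV[R]_n) (al : eform R n) : eform R n :=
  \sum_j covwedge (\row_i - christoffel j k i x) (insertion (cobase j) al).

Definition nabla (k : 'I_n) om : 'rV[R]_n -> dform R n := fun x =>
  [ffun s => pderiv k (fun y => om y s) x]
  + on_left (conn k x) (om x) + on_right (conn k x) (om x).

(* second covariant derivative nabla^2_(u,v); for coordinate fields it is
   nabla_(d_k) nabla_(d_l) om - nabla_(nabla_(d_k) d_l) om *)
Definition nabla2 u v om x : dform R n :=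
  \sum_k \sum_l (u 0 k * v 0 l) *:
    (nabla k (nabla l om) x - \sum_m christoffel m k l x *: nabla m om x).

Definition curv_op u v om x : dform R n := nabla2 v u om x - nabla2 u v om x.

(* R(d_i, d_j) d_l = \sum_m riem m l i j d_m, where R(X, Y) is
   [nabla_X, nabla_Y] - nabla_[X, Y] *)
Definition riem (m l i j : 'I_n) (x : 'rV[R]_n) : R :=
  pderiv i (christoffel m j l) x - pderiv j (christoffel m i l) x
  + \sum_a (christoffel m i a x * christoffel a j l x
            - christoffel m j a x * christoffel a i l x).

(* <R(d_i, d_j) d_l, d_k>, which is +1 on an orthonormal pair (i, j) = (k, l)
   of the unit round sphere *)
Definition riem4 (i j k l : 'I_n) (x : 'rV[R]_n) : R :=
  \sum_m G x k m * riem m l i j x.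

Definition Riem (x : 'rV[R]_n) : dform R n :=
  \sum_(ij : 'I_n * 'I_n | (ij.1 < ij.2)%N)
  \sum_(kl : 'I_n * 'I_n | (kl.1 < kl.2)%N)
    riem4 ij.1 ij.2 kl.1 kl.2 x *:
      tens (ebase R [set ij.1; ij.2]) (ebase R [set kl.1; kl.2]).

(* Ric(d_j, d_l) is the trace of X |-> R(X, d_j) d_l *)
Definition Ric (x : 'rV[R]_n) : dform R n :=
  bilform (\matrix_(j, l) \sum_m riem m l m j x).

(* the rows of e are an orthonormal basis of the tangent space at x *)
Definition orthonormal_at (x : 'rV[R]_n) (e : 'M[R]_n) :=
  e *m G x *m e^T = 1%:M.

Definition Weit (e : 'M[R]_n) om (x : 'rV[R]_n) : dform R n :=
  \sum_i \sum_j
    on_left (insertion (row i e))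
      (dfwedge (tens (covector (flat (G x) (row j e))) (ebase R set0))
              (curv_op (row i e) (row j e) om x)).

End LeviCivita.
End Charts.

Local Close Scope classical_set_scope.

(* The Clifford product exists: it is transported from the algebra generated by
   the operators al |-> a /\ al - iota_(a^#) al by antisymmetrization. *)
Section CliffordExistence.
Variables (R : realType) (n : nat).
Implicit Types (a b v : 'rV[R]_n) (al be ga : eform R n) (I J : {set 'I_n}).

Lemma esgnU i j I : j \notin I ->
  esgn R i (j |: I) = (-1) ^+ (j < i)%N * esgn R i I.
Proof.
move=> jI; rewrite /esgn -exprD; congr (_ ^+ _).
have [ji|ji] := boolP (j < i)%N.
  have -> : [set k in j |: I | (k < i)%N] = j |: [set k in I | (k < i)%N].
    by apply/setP => k; rewrite !inE; case: eqP => [->|].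
  by rewrite cardsU1 !inE (negPf jI).
rewrite add0n; apply: eq_card => k; rewrite !inE.
by case: eqP => [->|] //=; rewrite (negPf ji) andbF.
Qed.

Lemma esgnD i j I : j \in I ->
  esgn R i (I :\ j) = (-1) ^+ (j < i)%N * esgn R i I.
Proof.
move=> jI; have := @esgnU i j (I :\ j); rewrite setD11 setD1K// => -> //.
by rewrite mulrA -expr2 sqrr_sign mul1r.
Qed.

Lemma esgnn i I : esgn R i I * esgn R i I = 1.
Proof. by rewrite -expr2 sqrr_sign. Qed.

Lemma sgn_lt (i j : 'I_n) : i != j ->
  (-1) ^+ (i < j)%N = - (-1) ^+ (j < i)%N :> R.
Proof.
by rewrite -val_eqE /=; case: ltngtP => //= _ _; rewrite ?expr0 ?expr1 ?opprK.
Qed.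

Lemma covwedge_linear a : linear (covwedge a).
Proof.
move=> c al be; apply/ffunP => I; rewrite !ffunE scaler_sumr -big_split /=.
by apply: eq_bigr => i _; rewrite !ffunE mulrDr /GRing.scale /=; ring.
Qed.

Lemma insertion_linear a : linear (insertion a).
Proof.
move=> c al be; apply/ffunP => I; rewrite !ffunE scaler_sumr -big_split /=.
by apply: eq_bigr => i _; rewrite !ffunE mulrDr /GRing.scale /=; ring.
Qed.

HB.instance Definition _ a :=
  GRing.isLinear.Build R (eform R n) (eform R n) _ (covwedge a)
    (covwedge_linear a).
HB.instance Definition _ a :=
  GRing.isLinear.Build R (eform R n) (eform R n) _ (insertion a)
    (insertion_linear a).

Section LinearFacts.
Variable f : eform R n -> eform R n.
Hypothesis fl : linear f.

Let lf : {linear eform R n -> eform R n} :=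
  HB.pack f (GRing.isLinear.Build R (eform R n) (eform R n) _ f fl).

Lemma lin0 : f 0 = 0. Proof. exact: (linear0 lf). Qed.
Lemma linN x : f (- x) = - f x. Proof. exact: (linearN lf). Qed.
Lemma linB x y : f (x - y) = f x - f y. Proof. exact: (linearB lf). Qed.
Lemma linZ c x : f (c *: x) = c *: f x. Proof. exact: (linearZ_LR lf). Qed.
Lemma lin_sum (I : finType) (F : I -> eform R n) :
  f (\sum_i F i) = \sum_i f (F i).
Proof. exact: (linear_sum lf). Qed.
End LinearFacts.

Local Notation eps i := (covwedge (cobase i)).
Local Notation ins i := (insertion (cobase i)).

Lemma epsE i al I : eps i al I = (i \in I)%:R * (esgn R i I * al (I :\ i)).
Proof.
rewrite ffunE; have [iI|iI] := boolP (i \in I); last first.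
  rewrite mul0r big1// => j jI; rewrite mxE eqxx/=.
  by case: eqVneq jI iI => [->->//|]; rewrite mulr0 mul0r.
rewrite mul1r (bigD1 i)//= big1 ?addr0 => [|j /andP[_ ji]].
  by rewrite mxE !eqxx mulr1.
by rewrite mxE (negPf ji) andbF mulr0 mul0r.
Qed.

Lemma insE i al I : ins i al I = (i \notin I)%:R * (esgn R i I * al (i |: I)).
Proof.
rewrite ffunE; have [iI|iI] := boolP (i \in I).
  rewrite mul0r big1// => j jI; rewrite mxE eqxx/=.
  by case: eqVneq jI iI => [->|]; [move/negPf->|rewrite mulr0 mul0r].
rewrite mul1r (bigD1 i)//= big1 ?addr0 => [|j /andP[_ ji]].
  by rewrite mxE !eqxx mulr1.
by rewrite mxE (negPf ji) andbF mulr0 mul0r.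
Qed.

Lemma covwedgeE a al : covwedge a al = \sum_i a 0 i *: eps i al.
Proof.
apply/ffunP => I; rewrite ffunE big_mkcond sum_ffunE /=; apply: eq_bigr => i _.
rewrite [RHS]ffunE epsE /GRing.scale /=.
by case: (i \in I); rewrite ?mul0r ?mulr0// mul1r; ring.
Qed.

Lemma insertionE a al : insertion a al = \sum_i a 0 i *: ins i al.
Proof.
apply/ffunP => I; rewrite ffunE big_mkcond sum_ffunE /=; apply: eq_bigr => i _.
rewrite [RHS]ffunE insE /GRing.scale /=.
by case: (i \in I); rewrite ?mul0r ?mulr0// mul1r; ring.
Qed.


Lemma ins_eps i j al : ins i (eps j al) = (i == j)%:R *: al - eps j (ins i al).
Proof.
apply/ffunP => I; rewrite insE epsE 3!ffunE epsE insE !inE /GRing.scale /=.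
case: (eqVneq i j) => [<-|ij].
  rewrite ?eqxx /= mul1r; have [iI|iI] := boolP (i \in I).
    rewrite setD1K// mul0r !mul1r esgnD// ltnn mul1r mulrA esgnn mul1r.
    by rewrite subrr.
  by rewrite setU1K// !mul1r mul0r subr0 esgnU// ltnn mul1r mulrA esgnn mul1r.
rewrite mul0r add0r /=.
have [iI|iI] := boolP (i \in I); first by rewrite !(mul0r, mulr0) oppr0.
have [jI|jI] := boolP (j \in I); last by rewrite !(mul0r, mulr0) oppr0.
rewrite !mul1r esgnU// esgnD// (sgn_lt ij).
have -> : (i |: I) :\ j = i |: (I :\ j).
  by apply/setP => k; rewrite !inE; case: (eqVneq k i) => [->|]; rewrite ?ij.
ring.
Qed.

Lemma eps_eps i j al : eps i (eps j al) = - eps j (eps i al).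
Proof.
apply/ffunP => I; rewrite [RHS]ffunE !epsE !inE.
have [<-|ij] := eqVneq i j; first by rewrite ?eqxx !(mul0r, mulr0) oppr0.
rewrite ?(eq_sym j) ?ij /=.
have [iI|iI] := boolP (i \in I); last by rewrite !(mul0r, mulr0) oppr0.
have [jI|jI] := boolP (j \in I); last by rewrite !(mul0r, mulr0) oppr0.
rewrite !mul1r !esgnD// (sgn_lt ij) setDDl setUC -setDDl; ring.
Qed.

Lemma ins_ins i j al : ins i (ins j al) = - ins j (ins i al).
Proof.
apply/ffunP => I; rewrite [RHS]ffunE !insE !inE.
have [<-|ij] := eqVneq i j; first by rewrite ?eqxx !(mul0r, mulr0) oppr0.
rewrite ?(eq_sym j) ?(negPf ij) /=.
have [iI|iI] := boolP (i \in I); first by rewrite !(mul0r, mulr0) oppr0.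
have [jI|jI] := boolP (j \in I); first by rewrite !(mul0r, mulr0) oppr0.
rewrite !mul1r !esgnU// (sgn_lt ij) setUCA; ring.
Qed.


Lemma insertion_covwedge v a al : insertion v (covwedge a al) =
  (\sum_i v 0 i * a 0 i) *: al - covwedge a (insertion v al).
Proof.
have -> : covwedge a (insertion v al) =
    \sum_i \sum_j (v 0 i * a 0 j) *: eps j (ins i al).
  rewrite (insertionE v) linear_sum; apply: eq_bigr => i _.
  rewrite linearZ /= covwedgeE scaler_sumr; apply: eq_bigr => j _.
  by rewrite scalerA.
rewrite insertionE scaler_suml -sumrB; apply: eq_bigr => i _.
rewrite covwedgeE linear_sum scaler_sumr.
transitivity (\sum_j ((v 0 i * a 0 j * (i == j)%:R) *: al
    - (v 0 i * a 0 j) *: eps j (ins i al))).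
  by apply: eq_bigr => j _; rewrite linearZ /= ins_eps !scalerBr !scalerA.
rewrite sumrB; congr (_ - _); rewrite (bigD1 i)//= eqxx mulr1 big1 ?addr0//.
by move=> j ji; rewrite eq_sym (negPf ji) mulr0 scale0r.
Qed.

Lemma covwedge_covwedge a b al :
  covwedge a (covwedge b al) = - covwedge b (covwedge a al).
Proof.
rewrite (covwedgeE a (covwedge b al)) (covwedgeE a al) linear_sum -sumrN.
apply: eq_bigr => i _; rewrite linearZ /= -scalerN; congr (_ *: _).
rewrite !(covwedgeE b) linear_sum -sumrN; apply: eq_bigr => j _.
by rewrite linearZ /= eps_eps scalerN.
Qed.

Lemma insertion_insertion a b al :
  insertion a (insertion b al) = - insertion b (insertion a al).
Proof.
rewrite (insertionE a (insertion b al)) (insertionE a al) linear_sum -sumrN.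
apply: eq_bigr => i _; rewrite linearZ /= -scalerN; congr (_ *: _).
rewrite !(insertionE b) linear_sum -sumrN; apply: eq_bigr => j _.
by rewrite linearZ /= ins_ins scalerN.
Qed.

Lemma homogeneous_ins v p al :
  homogeneous p.+1 al -> homogeneous p (insertion v al).
Proof.
move=> hal I; rewrite ffunE => h.
suff [i iI h'] : exists2 i, i \notin I & al (i |: I) != 0.
  by have := hal _ h'; rewrite cardsU1 iI => -[].
apply/exists2P; apply: contraPP h => /forallNP h.
apply/negP; rewrite negbK big1// => i iI.
have [->|/eqP al0] := eqVneq (al (i |: I)) 0; first by rewrite mulr0.
by have := h i; rewrite iI; case; split=> //; apply/eqP.
Qed.

Lemma homogeneous_ins0 v al : homogeneous 0 al -> insertion v al = 0.
Proof.
move=> hal; apply/ffunP => I; rewrite !ffunE big1// => i iI.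
have [->|/hal] := eqVneq (al (i |: I)) 0; first by rewrite mulr0.
by rewrite cardsU1 iI.
Qed.

Lemma homogeneousZD p c al be :
  homogeneous p al -> homogeneous p be -> homogeneous p (c *: al + be).
Proof.
move=> ha hb I; rewrite !ffunE => h.
have [al0|/ha//] := eqVneq (al I) 0.
have [be0|/hb//] := eqVneq (be I) 0.
by move: h; rewrite al0 be0 scaler0 addr0 eqxx.
Qed.

Lemma homogeneous_cov b p al :
  homogeneous p al -> homogeneous p.+1 (covwedge b al).
Proof.
move=> hal I; rewrite ffunE => h.
suff [i iI h'] : exists2 i, i \in I & al (I :\ i) != 0.
  by rewrite (cardsD1 i) iI (hal _ h').
apply/exists2P; apply: contraPP h => /forallNP h.
apply/negP; rewrite negbK big1// => i iI.
have [->|/eqP al0] := eqVneq (al (I :\ i)) 0; first by rewrite mulr0.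
by have := h i; rewrite iI; case; split=> //; apply/eqP.
Qed.

Lemma homogeneous_base I : homogeneous #|I| (ebase R I).
Proof. by move=> J; rewrite ffunE; case: (eqVneq J I) => [->|]//; rewrite eqxx. Qed.

Lemma ebaseE al : al = \sum_I al I *: ebase R I.
Proof.
apply/ffunP => J; rewrite sum_ffunE (bigD1 J)//= !ffunE eqxx big1 ?addr0.
  by rewrite /GRing.scale /= mulr1.
by move=> I IJ; rewrite !ffunE eq_sym (negPf IJ) scaler0.
Qed.

Lemma euler p al : homogeneous p al -> \sum_i eps i (ins i al) = p%:R *: al.
Proof.
move=> hal; apply/ffunP => I; rewrite sum_ffunE !ffunE.
under eq_bigr => i _.
  rewrite epsE insE !inE eqxx /= mul1r.
  over.
rewrite /GRing.scale /=.
have [al0|/hal <-] := eqVneq (al I) 0.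
  rewrite al0 mulr0 big1// => i _.
  by have [iI|] := boolP (i \in I); rewrite ?mul0r// setD1K// al0 !mulr0.
rewrite -sum1_card natr_sum mulr_suml [RHS]big_mkcond /=; apply: eq_bigr => i _.
have [iI|] := boolP (i \in I); last by rewrite mul0r.
by rewrite setD1K// esgnD// ltnn !mul1r mulrA esgnn mul1r.
Qed.

(* Clifford multiplication by a covector, and the antisymmetrization map
   dx^i1 /\ ... /\ dx^ip |-> (1/p!) \sum_s sgn(s) c(dx^is1) o ... o c(dx^isp)
   in recursive form. *)
Variable G : 'M[R]_n.
Hypothesis Gsym : G^T = G.

Definition ccov : 'rV[R]_n -> eform R n -> eform R n :=
  locked (fun a al => covwedge a al - insertion (sharp G a) al).

Lemma ccovdef a al : ccov a al = covwedge a al - insertion (sharp G a) al.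
Proof. by rewrite /ccov -lock. Qed.

Fixpoint quant (p : nat) al be : eform R n :=
  if p is p'.+1 then
    (p%:R)^-1 *: \sum_i ccov (cobase i) (quant p' (ins i al) be)
  else al set0 *: be.

Definition cliff al be : eform R n := \sum_I al I *: quant #|I| (ebase R I) be.

Lemma ccov_linear a : linear (ccov a).
Proof.
move=> c al be; rewrite !ccovdef (linearP (covwedge a)) (linearP (insertion _)).
by rewrite scalerBr opprD addrACA.
Qed.

HB.instance Definition _ a :=
  GRing.isLinear.Build R (eform R n) (eform R n) _ (ccov a) (ccov_linear a).

Lemma ccovZ b c al : ccov b (c *: al) = c *: ccov b al.
Proof. exact: linearZ_LR. Qed.

Lemma ccovB b al be : ccov b (al - be) = ccov b al - ccov b be.
Proof. exact: linearB. Qed.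

Lemma ccovD b al be : ccov b (al + be) = ccov b al + ccov b be.
Proof. exact: linearD. Qed.

Lemma ccovN b al : ccov b (- al) = - ccov b al.
Proof. exact: linearN. Qed.

Definition ip a b : R := \sum_i sharp G a 0 i * b 0 i.

Lemma ipC a b : ip a b = ip b a.
Proof.
have E (x y : 'rV[R]_n) : ip x y = (x *m invmx G *m y^T) 0 0.
  by rewrite /ip /sharp mxE; apply: eq_bigr => i _; rewrite [y^T _ _]mxE.
rewrite !E -[in LHS](trmxK (a *m _ *m _)) mxE !trmx_mul trmxK trmx_inv Gsym.
by rewrite mulmxA.
Qed.

Lemma ip_cobase i a : ip a (cobase i) = sharp G a 0 i.
Proof.
rewrite /ip (bigD1 i)//= [cobase i 0 i]mxE !eqxx mulr1.
rewrite big1 ?addr0// => j ji.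
by rewrite [cobase i 0 j]mxE (negPf ji) andbF mulr0.
Qed.

Lemma ccov_ccov a b al :
  ccov a (ccov b al) = - ccov b (ccov a al) - (2 * ip a b) *: al.
Proof.
have E (x y : 'rV[R]_n) : ccov x (ccov y al) =
    covwedge x (covwedge y al) - covwedge x (insertion (sharp G y) al)
    - (ip x y *: al - covwedge y (insertion (sharp G x) al)
       - insertion (sharp G x) (insertion (sharp G y) al)).
  by rewrite !ccovdef (linearB (covwedge _)) (linearB (insertion _)) /=
    insertion_covwedge.
rewrite !E (covwedge_covwedge a b) (insertion_insertion (sharp G a)) (ipC b a).
move: (covwedge b (covwedge a al)) (covwedge a (insertion _ _)) => x1 x2.
move: (covwedge b (insertion _ _)) (insertion _ (insertion _ _)) => x3 x4.
by apply/ffunP => I; rewrite !ffunE /GRing.scale /=; ring.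
Qed.

Lemma quant_linear p be : linear (quant p ^~ be).
Proof.
elim: p => [|p IH] c x y /=; first by rewrite !ffunE scalerDl scalerA.
set k := _^-1; rewrite (scalerA c k) (mulrC c k) -(scalerA k c) -scalerDr.
congr (_ *: _); rewrite scaler_sumr -big_split /=; apply: eq_bigr => i _.
by rewrite (linearP (insertion _)) IH (linearP (ccov _)).
Qed.

Lemma quant_linearr p al : linear (quant p al).
Proof.
elim: p al => [|p IH] al c x y /=.
  by rewrite scalerDr !scalerA mulrC.
set k := _^-1; rewrite (scalerA c k) (mulrC c k) -(scalerA k c) -scalerDr.
congr (_ *: _); rewrite scaler_sumr -big_split /=; apply: eq_bigr => i _.
by rewrite IH (linearP (ccov _)).
Qed.

Lemma quantl0 p be : quant p 0 be = 0.
Proof. exact: (lin0 (quant_linear p be)). Qed.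

Lemma quantlN p al be : quant p (- al) be = - quant p al be.
Proof. exact: (linN (quant_linear p be)). Qed.

Lemma quantlB p x y be : quant p (x - y) be = quant p x be - quant p y be.
Proof. exact: (linB (quant_linear p be)). Qed.

Lemma quantlZ p c x be : quant p (c *: x) be = c *: quant p x be.
Proof. exact: (linZ (quant_linear p be)). Qed.

Lemma quantl_sum p (I : finType) (F : I -> eform R n) be :
  quant p (\sum_i F i) be = \sum_i quant p (F i) be.
Proof. exact: (lin_sum (quant_linear p be)). Qed.

Lemma quantS p al be :
  p.+1%:R *: quant p.+1 al be = \sum_i ccov (cobase i) (quant p (ins i al) be).
Proof. by rewrite /= scalerA mulfV ?scale1r// pnatr_eq0. Qed.

Lemma quant1 al be : quant 1 al be = \sum_i ccov (cobase i) (quant 0 (ins i al) be).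
Proof. by rewrite /= invr1 scale1r. Qed.

Lemma quant0E al be : quant 0 al be = al set0 *: be.
Proof. by []. Qed.

Arguments quant : simpl never.

Lemma ccovE b x : ccov b x = \sum_i b 0 i *: ccov (cobase i) x.
Proof.
rewrite ccovdef covwedgeE.
under [RHS]eq_bigr do rewrite ccovdef scalerBr.
rewrite sumrB; congr (_ - _).
rewrite insertionE.
under [RHS]eq_bigr do rewrite insertionE scaler_sumr.
rewrite exchange_big /=; apply: eq_bigr => j _.
under [RHS]eq_bigr do rewrite scalerA.
rewrite -scaler_suml -!ip_cobase; congr (_ *: _).
rewrite ipC /ip.
under [LHS]eq_bigr do rewrite mulrC.
by apply: eq_bigr => i _; rewrite -ip_cobase ipC ip_cobase.
Qed.

Lemma ip_ccov b x : \sum_i ip (cobase i) b *: ins i x = insertion (sharp G b) x.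
Proof. by rewrite insertionE; apply: eq_bigr => i _; rewrite ipC ip_cobase. Qed.

Lemma ins_cov i b al :
  ins i (covwedge b al) = b 0 i *: al - covwedge b (ins i al).
Proof.
rewrite insertion_covwedge (bigD1 i)//= !mxE !eqxx mul1r big1 ?addr0// => j ji.
by rewrite !mxE (negPf ji) andbF mul0r.
Qed.

Lemma quant_cov p b al be : homogeneous p al ->
  quant p.+1 (covwedge b al) be =
    ccov b (quant p al be) + quant p.-1 (insertion (sharp G b) al) be.
Proof.
elim: p al => [|p IH] al hal.
  rewrite quant1 /= (homogeneous_ins0 _ hal) quantl0 addr0.
  rewrite ccovE; apply: eq_bigr => i _.
  rewrite ins_cov (homogeneous_ins0 _ hal) linear0 subr0.
  by rewrite quantlZ ccovZ.
have p0 : p.+2%:R != 0 :> R by rewrite pnatr_eq0.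
apply: (scalerI p0); rewrite quantS.
transitivity (\sum_i (b 0 i *: ccov (cobase i) (quant p.+1 al be)
   + ccov b (ccov (cobase i) (quant p (ins i al) be))
   + 2 *: quant p (ip (cobase i) b *: ins i al) be
   + ccov (cobase i) (quant p.-1 (ins i (insertion (sharp G b) al)) be))).
  apply: eq_bigr => i _; rewrite ins_cov.
  rewrite quantlB !quantlZ ccovB ccovZ IH; last exact: homogeneous_ins.
  rewrite ccovD ccov_ccov insertion_insertion quantlN ccovN.
  move: (ccov b (ccov (cobase i) (quant p (ins i al) be))) => Y.
  move: (ccov (cobase i) (quant p.+1 al be)) (quant p (ins i al) be) => X Z.
  move: (ccov _ _) => W.
  by apply/ffunP => I; rewrite !ffunE /GRing.scale /=; ring.
rewrite !big_split /= -ccovE -linear_sum -(quantS p al be) -scaler_sumr.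
rewrite -quantl_sum ip_ccov linearZ_LR /=.
move: (quant p.+1 al be) => Q.
case: p IH hal p0 => [|p] IH hal p0.
  rewrite [X in _ + X]big1 => [|i _]; last first.
    rewrite homogeneous_ins0 ?linear0//; last exact: homogeneous_ins.
    by rewrite quantl0 linear0.
  rewrite addr0; move: (ccov b _) (quant _ _ _) => X Y.
  by apply/ffunP => I; rewrite !ffunE /GRing.scale /=; ring.
rewrite -(quantS p (insertion (sharp G b) al) be).
move: (ccov b _) (quant _ (insertion _ _) _) => X Y.
by apply/ffunP => I; rewrite !ffunE /GRing.scale /=; ring.
Qed.

Lemma cliffE p al be : homogeneous p al -> cliff al be = quant p al be.
Proof.
move=> hal; rewrite [in RHS](ebaseE al) quantl_sum.
apply: eq_bigr => I _; rewrite quantlZ /=.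
by have [->|/hal->//] := eqVneq (al I) 0; rewrite !scale0r.
Qed.

Lemma cliff_linearl be : linear (cliff ^~ be).
Proof.
move=> c x y; rewrite /cliff scaler_sumr -big_split /=.
by apply: eq_bigr => I _; rewrite !ffunE scalerDl scalerA.
Qed.

Lemma cliff_linearr al : linear (cliff al).
Proof.
move=> c x y; rewrite /cliff scaler_sumr -big_split /=.
apply: eq_bigr => I _.
by rewrite quant_linearr scalerDr !scalerA mulrC.
Qed.

Lemma cliffl0 be : cliff 0 be = 0.
Proof. exact: (lin0 (cliff_linearl be)). Qed.

Lemma clifflN al be : cliff (- al) be = - cliff al be.
Proof. exact: (linN (cliff_linearl be)). Qed.

Lemma clifflB x y be : cliff (x - y) be = cliff x be - cliff y be.
Proof. exact: (linB (cliff_linearl be)). Qed.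

Lemma clifflZ c x be : cliff (c *: x) be = c *: cliff x be.
Proof. exact: (linZ (cliff_linearl be)). Qed.

Lemma cliffl_sum (I : finType) (F : I -> eform R n) be :
  cliff (\sum_i F i) be = \sum_i cliff (F i) be.
Proof. exact: (lin_sum (cliff_linearl be)). Qed.

Lemma cliff_ccov b al be : cliff (ccov b al) be = ccov b (cliff al be).
Proof.
rewrite (ebaseE al) linear_sum !cliffl_sum linear_sum /=.
apply: eq_bigr => I _; rewrite ccovZ !clifflZ /=.
rewrite ccovZ /=; congr (_ *: _).
have hI := @homogeneous_base I.
rewrite ccovdef clifflB /=.
rewrite (cliffE _ (homogeneous_cov hI)) quant_cov// (cliffE _ hI).
apply/eqP; rewrite subr_eq; apply/eqP; congr (_ + _).
case: #|I| hI => [|p] hI /=; last by rewrite (cliffE _ (homogeneous_ins hI)).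
by rewrite homogeneous_ins0// cliffl0 quantl0.
Qed.

Local Notation one := (ebase R set0 : eform R n).

Lemma cliff1 be : cliff one be = be.
Proof.
have h := @homogeneous_base set0; rewrite cards0 in h.
by rewrite (cliffE _ h) quant0E ffunE eqxx scale1r.
Qed.

Lemma ccov_ind (P : eform R n -> Prop) :
  (forall c al be, P al -> P be -> P (c *: al + be)) -> P one ->
  (forall b al, P al -> P (ccov b al)) -> forall al, P al.
Proof.
move=> PD P1 Pc.
have P0 : P 0 by rewrite -(subrr one) -scaleN1r addrC; apply: PD.
have Psum (I : finType) (F : I -> eform R n) : (forall i, P (F i)) ->
    P (\sum_i F i).
  move=> PF; elim/big_rec: _ => // i x _ Px.
  by rewrite -[F i]scale1r; exact: PD.
suff H p al : (homogeneous p al) -> P al.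
  move=> al; rewrite (ebaseE al); apply: Psum => I.
  rewrite -[X in P X]addr0; apply: PD => //; apply: H; exact: homogeneous_base.
have [m] := ubnP p; elim: m p al => // m IH [|p] al /ltnSE pm hal.
  suff -> : al = al set0 *: one + 0 by exact: PD.
  rewrite addr0 [LHS]ebaseE (bigD1 set0)//= big1 ?addr0// => I I0.
  have [->|/hal/eqP] := eqVneq (al I) 0; first by rewrite scale0r.
  by rewrite cards_eq0 (negPf I0).
have -> : al = p.+1%:R^-1 *:
    \sum_i (1 *: ccov (cobase i) (ins i al)
            + insertion (sharp G (cobase i)) (ins i al)) + 0.
  rewrite addr0; apply: (@scalerI _ _ (p.+1%:R)); first by rewrite pnatr_eq0.
  rewrite scalerA mulfV ?pnatr_eq0// scale1r -(euler hal).
  by apply: eq_bigr => i _; rewrite scale1r ccovdef subrK.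
apply: (PD) => //; apply: Psum => i.
have hi := @homogeneous_ins (cobase i) _ _ hal.
apply: PD; first by apply: Pc; apply: IH hi.
case: p pm hal hi => [|p] pm hal hi; first by rewrite homogeneous_ins0.
by apply: (IH p); [exact: ltnW | exact: homogeneous_ins].
Qed.

Lemma covwedge1 a : covwedge a one = covector a.
Proof.
rewrite covwedgeE; apply: eq_bigr => i _; congr (_ *: _).
apply/ffunP => I; rewrite epsE !ffunE.
have -> : (I == [set i]) = (i \in I) && (I :\ i == set0).
  apply/eqP/andP => [->|[iI /eqP I0]]; first by rewrite inE eqxx setDv eqxx.
  by rewrite -(setD1K iI) I0 setU0.
case: (i \in I); rewrite ?mul0r// mul1r.
case: eqP => /= [I0|]; rewrite ?mulr0// mulr1 /esgn.
rewrite (_ : [set j in I | (j < i)%N] = set0) ?cards0 ?expr0//.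
apply/setP => j; rewrite !inE; apply/negP => /andP[jI ji].
have := in_set0 j; rewrite -I0 !inE jI andbT => /negbFE/eqP jE.
by rewrite jE ltnn in ji.
Qed.

Lemma ccov1 a : ccov a one = covector a.
Proof.
have h := @homogeneous_base set0; rewrite cards0 in h.
by rewrite ccovdef (homogeneous_ins0 _ h) subr0 covwedge1.
Qed.

Definition parity al : eform R n := [ffun I : {set 'I_n} => (-1) ^+ #|I| * al I].

Lemma parity_linear : linear parity.
Proof. by move=> c x y; apply/ffunP => I; rewrite !ffunE /GRing.scale /=; ring. Qed.

Lemma parity_homogeneous p al : homogeneous p al -> parity al = (-1) ^+ p *: al.
Proof.
move=> hal; apply/ffunP => I; rewrite !ffunE.
by have [->|/hal->//] := eqVneq (al I) 0; rewrite mulr0 scaler0.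
Qed.

Lemma parity_cov b al : parity (covwedge b al) = - covwedge b (parity al).
Proof.
apply/ffunP => I; rewrite !ffunE mulr_sumr -sumrN; apply: eq_bigr => i iI.
by rewrite ffunE (cardsD1 i I) iI exprS; ring.
Qed.

Lemma parity_ins b al : parity (insertion b al) = - insertion b (parity al).
Proof.
apply/ffunP => I; rewrite !ffunE mulr_sumr -sumrN; apply: eq_bigr => i iI.
by rewrite ffunE cardsU1 iI exprS; ring.
Qed.

Definition rcov b al : eform R n :=
  covwedge b (parity al) + insertion (sharp G b) (parity al).

Lemma rcov_linear b : linear (rcov b).
Proof.
move=> c x y; rewrite /rcov parity_linear.
by rewrite (linearP (covwedge b)) (linearP (insertion _)) /= scalerDr addrACA.
Qed.

Lemma rcov_ccov a b al : rcov b (ccov a al) = ccov a (rcov b al).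
Proof.
rewrite /rcov !ccovdef (linB parity_linear) parity_cov parity_ins.
move: (parity al) => x.
rewrite opprK !(linearD (covwedge _)) !(linearD (insertion _)) /=.
rewrite !(linearN (covwedge _)) !(linearN (insertion _)) /= !insertion_covwedge.
rewrite -!/(ip _ _) (covwedge_covwedge b a) (insertion_insertion _ (sharp G a)).
rewrite (ipC b a).
move: (covwedge a (covwedge b x)) (insertion _ (insertion _ _)) => x1 x2.
move: (covwedge a (insertion _ _)) (covwedge b (insertion _ _)) => x3 x4.
by apply/ffunP => I; rewrite !ffunE /GRing.scale /=; ring.
Qed.

Lemma cliff_rcov b al : cliff al (covector b) = rcov b al.
Proof.
move: al; apply: ccov_ind => [c x y hx hy||a x hx].
- by rewrite cliff_linearl hx hy rcov_linear.
- have h := @homogeneous_base set0; rewrite cards0 in h.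
  rewrite cliff1 /rcov (parity_homogeneous h) expr0 scale1r.
  by rewrite (homogeneous_ins0 _ h) addr0 covwedge1.
- by rewrite cliff_ccov hx rcov_ccov.
Qed.

Lemma cliff_is_clifford : is_clifford G cliff.
Proof.
split.
- by move=> c x y z; rewrite cliff_linearl.
- by move=> c x y z; rewrite cliff_linearr.
- move=> x y z; move: x; apply: ccov_ind => [c x x' hx hx'||a x hx].
  + by rewrite !cliff_linearl hx hx'.
  + by rewrite !cliff1.
  + by rewrite !cliff_ccov hx.
- by move=> a x; rewrite -ccov1 cliff_ccov cliff1 ccovdef.
- move=> a p x hx; rewrite cliff_rcov /rcov (parity_homogeneous hx).
  by rewrite !linearZ_LR scalerDr.
Qed.

Lemma cliffordP : is_clifford G (clifford G).
Proof. exact: (xgetPex _ (ex_intro _ cliff cliff_is_clifford)). Qed.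

End CliffordExistence.

(* Main.v *)
Require Import Defs.
From HB Require Import structures.
From mathcomp Require Import all_boot all_order all_algebra.
From mathcomp Require Import boolp classical_sets reals topology normedtype derive.
From mathcomp Require Import ring lra.
From mathcomp Require Import finset.
Set Implicit Arguments.
Unset Strict Implicit.
Unset Printing Implicit Defensive.
Import Order.TTheory GRing.Theory Num.Theory numFieldNormedType.Exports.
Local Open Scope ring_scope.

(** In a chart, write R_ijkl for riem4, e_a for the exterior multiplication by
    dx^a and i_a for the insertion of the vector dual to dx^a, so that
    i_a e_b + e_b i_a = g^ab.  Both sides of the formula turn out to be zeroth
    order operators built from products of e's and i's, acting on the left (L)
    and on the right (R) factor, and they are compared as such.

    - The connection differs from the componentwise derivative by constant
      coefficient operators, the images of the elementary matrices under the
      action of gl_n on double forms (delem).  Since second partial derivatives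
      commute (deriveC), the commutator of two covariant derivatives is the
      action of the Riemann tensor, by the commutation relations of gl_n
      (nabla_comm, curv_opE).
    - An orthonormal frame e satisfies e^T e = g^-1, so the sum over the frame in
      Weit contracts to a sum over coordinates (frame_contraction), and
      Weit = sum R_klba (e_k i_l)^L ((e_a i_b)^L + (e_a i_b)^R)  (WeitE).
    - The adjoint of e_j for the inner product of forms is i_j, hence composing
      with g . B is sum_a e_a (comp_act B) c_a, where c_a inserts the coordinate
      vector d_a (comp_act_metric): the metric disappears.  By Euler's identity
      sum_a e_a c_a is the degree, so on forms of degree p composing with
      g^(p-r) B / (p-r)! is given by one formula for all p.  For Ric this is
      sum Ric_jk e_j i_k (comp_act_ric), for the curvature tensor it is the sum
      of R_ijkl e_i e_j i_l i_k over i < j, k < l (comp_act_riem).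
    - The Clifford commutator with dx^i /\ dx^j is 2 (e_j i_i - e_i i_j)
      (ecomm_ebase2), so the sharp product with the curvature tensor is
      4 sum R_ijkl (e_i i_j)^L (e_k i_l)^R (dfsharp_curv).

    The L-R part of WeitE is thus -1/4 of the sharp product.  In the L-L part,
    e_k i_l e_a i_b = g^la e_k i_b - e_k e_a i_l i_b: the first term gives the
    Ricci curvature, and the first Bianchi identity turns the second into the
    curvature tensor term (weitzenboeck_left).  The symmetries of R that are
    needed are read off from the expression of R_ijkl by second derivatives of
    the metric and a quadratic term in the Christoffel symbols (riem4E). *)

(** * Symmetry of second directional derivatives *)

Section Schwarz.
Variables (R : realType) (V : normedModType R).
Implicit Types (F : V -> R) (x y u v : V).
Local Open Scope classical_set_scope.

Lemma is_derive_line F y u (s : R) : derivable F (y + s *: u) u ->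
  is_derive s 1 (fun t : R => F (y + t *: u)) ('D_u F (y + s *: u)).
Proof.
move=> dF.
have E : (fun h : R => h^-1 *:
      (((fun t : R => F (y + t *: u)) \o shift s) (h *: 1) - F (y + s *: u))) =
    (fun h : R => h^-1 *: ((F \o shift (y + s *: u)) (h *: u) - F (y + s *: u))).
  apply/funext => h /=; congr (_ *: (F _ - _)).
  by rewrite scalerDl [h *: 1]mulr1 addrCA.
by split; [rewrite /derivable E|rewrite /derive E].
Qed.

Lemma line_MVT F y u (h : R) : 0 < h ->
  (forall s, 0 <= s <= h -> derivable F (y + s *: u) u) ->
  exists2 s, 0 <= s <= h & F (y + h *: u) - F y = 'D_u F (y + s *: u) * h.
Proof.
move=> h0 dF.
have dl s : s \in `[0, h]%R ->
    is_derive s 1 (fun t : R => F (y + t *: u)) ('D_u F (y + s *: u)).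
  by rewrite in_itv /= => sh; apply/is_derive_line/dF.
have dl' s : s \in `]0, h[%R ->
    is_derive s 1 (fun t : R => F (y + t *: u)) ('D_u F (y + s *: u)).
  rewrite in_itv /= => /andP[/ltW s0 /ltW sh].
  by apply: dl; rewrite in_itv /= s0.
have cl : {within `[0, h], continuous (fun t : R => F (y + t *: u))}.
  by apply: derivable_within_continuous => s sh; have [] := dl s sh.
have [s] := MVT h0 dl' cl.
rewrite in_itv /= => /andP[/ltW s0 /ltW sh].
by rewrite subr0 scale0r addr0 => ->; exists s; rewrite ?s0.
Qed.

Definition second_diff F x u v (h : R) :=
  (F (x + h *: u + h *: v) - F (x + h *: u) - (F (x + h *: v) - F x)) / (h * h).

(** Two applications of the mean value theorem, first along u to the increment
    of F along v and then along v, write the second difference as the mixed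
    derivative at a point that tends to x. *)
Lemma second_diff_cvg F x u v :
  (\near x, derivable F x u) -> (\near x, derivable ('D_u F) x v) ->
  {for x, continuous ('D_v ('D_u F))} ->
  second_diff F x u v h @[h --> 0^'+] --> 'D_v ('D_u F) x.
Proof.
move=> d1 d2 c; apply/cvgrPdist_lt => eps eps0.
have c' : \forall y \near x, `|'D_v ('D_u F) x - 'D_v ('D_u F) y| < eps.
  by move/cvgrPdist_lt : c; apply.
have /nbhs_normP[r /= r0 rP] : \forall y \near x, [/\ derivable F y u,
    derivable ('D_u F) y v & `|'D_v ('D_u F) x - 'D_v ('D_u F) y| < eps].
  by apply: filterS3 d1 d2 c' => y.
have N0 : 0 < `|u| + `|v| + 1 :> R by rewrite ltr_wpDl// addr_ge0.
near=> h.
have h0 : 0 < h by [].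
have hr : h * (`|u| + `|v| + 1) < r.
  by rewrite -ltr_pdivlMr//; near: h; apply: nbhs_right_lt; rewrite divr_gt0.
have P s t : 0 <= s <= h -> 0 <= t <= h -> [/\ derivable F (x + s *: u + t *: v) u,
   derivable ('D_u F) (x + s *: u + t *: v) v
   & `|'D_v ('D_u F) x - 'D_v ('D_u F) (x + s *: u + t *: v)| < eps].
  move=> /andP[s0 sh] /andP[t0 th]; apply: rP.
  rewrite /= -addrA opprD addNKr normrN (le_lt_trans (ler_normD _ _))//.
  rewrite !normrZ !ger0_norm//; apply: le_lt_trans hr.
  rewrite !mulrDr mulr1 ler_wpDr ?(ltW h0)// lerD// ler_wpM2r//.
have P0 s : 0 <= s <= h -> [/\ derivable F (x + s *: u) u,
   derivable ('D_u F) (x + s *: u) v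
   & `|'D_v ('D_u F) x - 'D_v ('D_u F) (x + s *: u)| < eps].
  by move=> sh; have := P s 0 sh; rewrite scale0r addr0 lexx (ltW h0) => /(_ isT).
have hh : 0 <= h <= h by rewrite lexx ltW.
(* the increment of F along v, to which the mean value theorem is applied
   along u *)
pose F' y := F (y + h *: v) - F y.
have dF' s : 0 <= s <= h -> is_derive (x + s *: u) u F'
    ('D_u F (x + s *: u + h *: v) - 'D_u F (x + s *: u)).
  move=> sh; apply: is_deriveB; last by apply: derivableP; have [] := P0 s sh.
  have [dF _ _] := P s h sh hh.
  have E : (fun k : R => k^-1 *: (((fun y => F (y + h *: v)) \o shift (x + s *: u))
        (k *: u) - F (x + s *: u + h *: v))) =
      (fun k : R => k^-1 *: ((F \o shift (x + s *: u + h *: v)) (k *: u)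
        - F (x + s *: u + h *: v))).
    by apply/funext => k /=; rewrite !addrA.
  by split; [rewrite /derivable E|rewrite /derive E].
have [|s sh Es] := @line_MVT F' x u h h0.
  by move=> s /dF' [].
have [|t th Et] := @line_MVT ('D_u F) (x + s *: u) v h h0.
  by move=> t th; have [] := P s t sh th.
have [_ _] := P s t sh th; rewrite /second_diff.
have -> : F (x + h *: u + h *: v) - F (x + h *: u) - (F (x + h *: v) - F x)
   = F' (x + h *: u) - F' x by [].
rewrite Es; have /(@derive_val _ _ _ _ _ _ _) -> := dF' s sh.
by rewrite Et -mulrA mulfK// mulf_neq0// gt_eqF.
Unshelve. all: by end_near. Qed.

(** Schwarz's theorem: the second difference is symmetric in u and v, and both
    mixed derivatives are its limit. *)
Lemma deriveC F x u v :
  (\near x, derivable F x u) -> (\near x, derivable F x v) ->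
  (\near x, derivable ('D_u F) x v) -> (\near x, derivable ('D_v F) x u) ->
  {for x, continuous ('D_v ('D_u F))} -> {for x, continuous ('D_u ('D_v F))} ->
  'D_v ('D_u F) x = 'D_u ('D_v F) x.
Proof.
move=> du dv duv dvu cuv cvu.
have /cvg_lim <- // := second_diff_cvg du duv cuv.
have E : second_diff F x u v = second_diff F x v u.
  apply/funext => h; rewrite /second_diff (addrAC x (h *: u)); congr (_ / _).
  move: (F _) (F _) (F _) (F _) => a b c d; ring.
rewrite E; exact/cvg_lim/second_diff_cvg.
Qed.
End Schwarz.

(** * Smooth functions on an open set, and matrices of derivable functions *)

Section SmoothFunctions.
Variables (R : realType) (n : nat) (U : set 'rV[R]_n).
Hypothesis Uopen : open U.
Implicit Types (f : 'rV[R]_n -> R) (x : 'rV[R]_n).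

Lemma smooth_derivable f i x : smooth_on U f -> U x -> derivable f x (cobase i).
Proof. by move=> sf Ux; have [_ /(_ i)[+ _]] := sf 1; apply. Qed.

Lemma smooth_pderiv f i : smooth_on U f -> smooth_on U (pderiv i f).
Proof. by move=> sf k; have [_ /(_ i)[]] := sf k.+1. Qed.

Lemma smooth_continuous f x : smooth_on U f -> U x -> {for x, continuous f}.
Proof. by move=> sf Ux; have [+ _] := sf 0; apply. Qed.

Lemma near_open (P : 'rV[R]_n -> Prop) x : U x -> (forall y, U y -> P y) ->
  \forall y \near x, P y.
Proof. by move=> Ux UP; apply: filterS UP _; exact: open_nbhs_nbhs. Qed.

Lemma pderivC f i j x : smooth_on U f -> U x ->
  pderiv i (pderiv j f) x = pderiv j (pderiv i f) x.
Proof.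
move=> sf Ux; apply: deriveC.
- by apply: near_open Ux _ => y Uy; exact: smooth_derivable.
- by apply: near_open Ux _ => y Uy; exact: smooth_derivable.
- by apply: near_open Ux _ => y Uy; apply/smooth_derivable/Uy/smooth_pderiv.
- by apply: near_open Ux _ => y Uy; apply/smooth_derivable/Uy/smooth_pderiv.
- by apply/smooth_continuous/Ux/smooth_pderiv/smooth_pderiv.
- by apply/smooth_continuous/Ux/smooth_pderiv/smooth_pderiv.
Qed.

Lemma pderiv_near f f' i x : U x -> (forall y, U y -> f y = f' y) ->
  pderiv i f x = pderiv i f' x.
Proof. by move=> Ux E; apply: near_eq_derive; exact: near_open. Qed.
End SmoothFunctions.

Section DerivableMatrix.
Variables (R : realType) (V : normedModType R) (x v : V).

Lemma derivable_bigsum (I : Type) (r : seq I) (P : pred I) (F : I -> V -> R) :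
  (forall i, P i -> derivable (F i) x v) ->
  derivable (fun y => \sum_(i <- r | P i) F i y) x v.
Proof.
move=> dF; elim: r => [|i r IH].
  under eq_fun do rewrite big_nil; exact: derivable_cst.
under eq_fun do rewrite big_cons.
case: ifP => Pi; last exact: IH.
by apply: derivableD; [exact: dF|exact: IH].
Qed.

Lemma derivable_bigprod (I : Type) (r : seq I) (P : pred I) (F : I -> V -> R) :
  (forall i, P i -> derivable (F i) x v) ->
  derivable (fun y => \prod_(i <- r | P i) F i y) x v.
Proof.
move=> dF; elim: r => [|i r IH].
  under eq_fun do rewrite big_nil; exact: derivable_cst.
under eq_fun do rewrite big_cons.
case: ifP => Pi; last exact: IH.
by apply: derivableM; [exact: dF|exact: IH].
Qed.

Lemma derive_bigsum (I : Type) (r : seq I) (P : pred I) (F : I -> V -> R) :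
  (forall i, P i -> derivable (F i) x v) ->
  'D_v (fun y => \sum_(i <- r | P i) F i y) x = \sum_(i <- r | P i) 'D_v (F i) x.
Proof.
move=> dF; elim: r => [|i r IH].
  under eq_fun do rewrite big_nil; rewrite big_nil; exact: derive_cst.
under eq_fun do rewrite big_cons; rewrite big_cons.
case: ifP => // Pi; rewrite -IH; apply: deriveD; first exact: dF.
exact: derivable_bigsum.
Qed.

Lemma derive_cmul (c : R) (f : V -> R) :
  derivable f x v -> 'D_v (fun y => c * f y) x = c * 'D_v f x.
Proof. by move=> df; exact: deriveZ. Qed.

Lemma derive_mul (f g : V -> R) : derivable f x v -> derivable g x v ->
  'D_v (fun y => f y * g y) x = 'D_v f x * g x + f x * 'D_v g x.
Proof.
move=> df dg; apply: etrans (deriveM df dg) _.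
by rewrite /GRing.scale /= addrC [in X in X + _]mulrC.
Qed.

Lemma derive_sub (f g : V -> R) : derivable f x v -> derivable g x v ->
  'D_v (fun y => f y - g y) x = 'D_v f x - 'D_v g x.
Proof. by move=> df dg; exact: deriveB. Qed.

Lemma derivable_det m (A : V -> 'M[R]_m) :
  (forall i j, derivable (fun y => A y i j) x v) ->
  derivable (fun y => \det (A y)) x v.
Proof.
move=> dA; rewrite /determinant; apply: derivable_bigsum => s _.
apply: derivableM; first exact: derivable_cst.
exact: derivable_bigprod.
Qed.

Lemma derivable_invmx m (A : V -> 'M[R]_m) i j :
  (\near x, A x \in unitmx) ->
  (forall i j, derivable (fun y => A y i j) x v) ->
  derivable (fun y => invmx (A y) i j) x v.
Proof.
move=> uA dA; have Ax := nbhs_singleton uA.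
apply: (@near_eq_derivable _ _ _ (fun y => (\det (A y))^-1 * \adj (A y) i j)).
  by near do rewrite /invmx ifT ?mxE//.
apply: derivableM.
  by apply: derivableV; [rewrite -unitfE -unitmxE|exact: derivable_det].
under eq_fun do rewrite mxE /cofactor.
apply: derivableM; first exact: derivable_cst.
apply: derivable_det => k l; under eq_fun do rewrite !mxE; exact: dA.
Unshelve. all: by end_near. Qed.
End DerivableMatrix.

(** * Christoffel symbols and the symmetries of the Riemann tensor *)

Section RiemannSymmetries.
Variables (R : realType) (n : nat) (U : set 'rV[R]_n) (G : 'rV[R]_n -> 'M[R]_n).
Hypothesis Uopen : open U.
Hypothesis Gsmooth : forall i j, smooth_on U (fun y => G y i j).
Hypothesis Gsym : forall y, U y -> (G y)^T = G y.
Hypothesis Gunit : forall y, U y -> G y \in unitmx.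
Implicit Types (x : 'rV[R]_n) (i j k l m : 'I_n).

Local Notation dG i k l := (pderiv i (fun y => G y k l)).
Local Notation Gam := (christoffel G).

(** Christoffel symbols of the first kind. *)
Definition christoffel1 k i j x : R :=
  2^-1 * (dG i k j x + dG j k i x - dG k i j x).
Local Notation Gam1 := christoffel1.

Lemma metricC x k l : U x -> G x k l = G x l k.
Proof. by move=> Ux; rewrite -{1}(Gsym Ux) mxE. Qed.

Lemma dmetricC i k l x : U x -> dG i k l x = dG i l k x.
Proof. by move=> Ux; apply: (pderiv_near Uopen _ Ux) => y; exact: metricC. Qed.

Lemma christoffel_first m i j x :
  Gam m i j x = \sum_k invmx (G x) m k * Gam1 k i j x.
Proof.
by rewrite /christoffel mulr_sumr; apply: eq_bigr => k _; rewrite mulrCA.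
Qed.

Lemma lower_christoffel k i j x : U x ->
  \sum_m G x k m * Gam m i j x = Gam1 k i j x.
Proof.
move=> Ux; under eq_bigr do rewrite christoffel_first mulr_sumr.
rewrite exchange_big /= (bigD1 k)//= [X in _ + X]big1 => [|h hk]; last first.
  under eq_bigr do rewrite mulrA; rewrite -mulr_suml.
  have := congr1 (fun A : 'M__ => A k h) (mulmxV (Gunit Ux)).
  by rewrite !mxE eq_sym (negPf hk) => ->; rewrite mul0r.
under eq_bigr do rewrite mulrA; rewrite -mulr_suml.
have := congr1 (fun A : 'M__ => A k k) (mulmxV (Gunit Ux)).
by rewrite !mxE eqxx => ->; rewrite mul1r addr0.
Qed.

Lemma christoffel1C k i j x : U x -> Gam1 k i j x = Gam1 k j i x.
Proof. by move=> Ux; rewrite /Gam1 (dmetricC k i j Ux) (addrC (dG i k j x)). Qed.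

Lemma christoffelC m i j x : U x -> Gam m i j x = Gam m j i x.
Proof.
move=> Ux; rewrite !christoffel_first; apply: eq_bigr => k _.
by rewrite christoffel1C.
Qed.

(** The metric is parallel. *)
Lemma dmetricE i k l x : U x -> dG i k l x = Gam1 k i l x + Gam1 l i k x.
Proof.
by move=> Ux; rewrite /Gam1 (dmetricC _ l k Ux) (dmetricC k l i Ux)
  (dmetricC l k i Ux); field.
Qed.

Lemma derivable_christoffel m i j h x : U x -> derivable (Gam m i j) x (cobase h).
Proof.
move=> Ux; apply: derivableM; first exact: derivable_cst.
apply: derivable_bigsum => k _; apply: derivableM.
  apply: derivable_invmx; first exact: (near_open Uopen Ux).
  by move=> a b; exact: smooth_derivable.
have dd a b c : derivable (dG a b c) x (cobase h).
  by apply: smooth_derivable (Ux) => //; exact: smooth_pderiv.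
by apply: derivableB; [apply: derivableD|].
Qed.

Lemma pderiv_christoffel1 h k i j x : U x -> pderiv h (Gam1 k i j) x =
  2^-1 * (pderiv h (dG i k j) x + pderiv h (dG j k i) x - pderiv h (dG k i j) x).
Proof.
move=> Ux.
have dd a b c : derivable (dG a b c) x (cobase h).
  by apply: smooth_derivable (Ux) => //; exact: smooth_pderiv.
have dS := derivableD (dd i k j) (dd j k i).
have E := deriveZ 2^-1 (derivableB dS (dd k i j)).
rewrite (deriveB dS (dd k i j)) (deriveD (dd i k j) (dd j k i)) in E.
exact: E.
Qed.

(** The product rule for lower_christoffel: the inverse matrix inside the
    Christoffel symbols need not be differentiated explicitly. *)
Lemma lower_dchristoffel h k i j x : U x ->
  \sum_m G x k m * pderiv h (Gam m i j) x =
  pderiv h (Gam1 k i j) x - \sum_m dG h k m x * Gam m i j x.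
Proof.
move=> Ux; apply/eqP; rewrite eq_sym subr_eq eq_sym; apply/eqP.
have <- : pderiv h (fun y => \sum_m G y k m * Gam m i j y) x = pderiv h (Gam1 k i j) x.
  by apply: (pderiv_near Uopen _ Ux) => y; exact: lower_christoffel.
have dg m : derivable (fun y => G y k m) x (cobase h) by exact: smooth_derivable.
have dc m : derivable (Gam m i j) x (cobase h) by exact: derivable_christoffel.
rewrite /pderiv derive_bigsum => [|m _]; last by apply: derivableM.
rewrite -big_split; apply: eq_bigr => m _ /=.
have E := deriveM (dg m) (dc m).
by apply/esym/(etrans E); rewrite /GRing.scale /=; ring.
Qed.

(** The inner product of nabla_(d_i) d_k and nabla_(d_j) d_l. *)
Definition quadchr i k j l x := \sum_m Gam1 m i k x * Gam m j l x.
Local Notation Q := quadchr.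

(** The quadratic term is the metric applied to two Christoffel symbols of the
    second kind, which makes it symmetric in the two pairs. *)
Lemma quadchr_swap i k j l x : U x -> Q i k j l x = Q j l i k x.
Proof.
move=> Ux.
have E a b c d : Q a b c d x =
    \sum_m \sum_h G x m h * Gam h a b x * Gam m c d x.
  by apply: eq_bigr => m _; rewrite -lower_christoffel// mulr_suml.
rewrite !E exchange_big; apply: eq_bigr => m _; apply: eq_bigr => h _ /=.
by rewrite (metricC h m Ux); ring.
Qed.

Lemma quadchrCl i k j l x : U x -> Q i k j l x = Q k i j l x.
Proof. by move=> Ux; apply: eq_bigr => m _; rewrite christoffel1C. Qed.

Lemma quadchrCr i k j l x : U x -> Q i k j l x = Q i k l j x.
Proof. by move=> Ux; apply: eq_bigr => m _; rewrite christoffelC. Qed.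

(** The derivative of the metric in lower_dchristoffel combines with the terms
    quadratic in the Christoffel symbols by metric compatibility.  Every symmetry
    of the curvature tensor is visible on the right-hand side. *)
Lemma riem4E i j k l x : U x -> riem4 G i j k l x =
  2^-1 * (pderiv i (dG l k j) x - pderiv i (dG k j l) x
          - pderiv j (dG l k i) x + pderiv j (dG k i l) x)
  - Q i k j l x + Q j k i l x.
Proof.
move=> Ux; rewrite /riem4.
have half a b :
    \sum_m G x k m * (pderiv a (Gam m b l) x + \sum_h Gam m a h x * Gam h b l x) =
    pderiv a (Gam1 k b l) x - Q a k b l x.
  have E : \sum_m G x k m * \sum_h Gam m a h x * Gam h b l x =
      \sum_h Gam1 k a h x * Gam h b l x.
    under eq_bigr do rewrite mulr_sumr.
    rewrite exchange_big; apply: eq_bigr => h _ /=.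
    by under eq_bigr do rewrite mulrA; rewrite -mulr_suml lower_christoffel.
  under eq_bigr do rewrite mulrDr.
  rewrite big_split /= E lower_dchristoffel// -addrA; congr (_ + _).
  rewrite addrC -opprB -sumrB; congr (- _).
  by apply: eq_bigr => m _; rewrite (dmetricE a k m Ux); ring.
transitivity (pderiv i (Gam1 k j l) x - Q i k j l x
              - (pderiv j (Gam1 k i l) x - Q j k i l x)).
  transitivity (
    \sum_m G x k m * (pderiv i (Gam m j l) x + \sum_h Gam m i h x * Gam h j l x)
    - \sum_m G x k m * (pderiv j (Gam m i l) x + \sum_h Gam m j h x * Gam h i l x)).
    rewrite -sumrB; apply: eq_bigr => m _.
    by rewrite -mulrBr opprD addrACA -sumrB.
  by congr (_ - _); exact: half.
rewrite (pderiv_christoffel1 i k j l Ux).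
rewrite (pderiv_christoffel1 j k i l Ux).
rewrite (pderivC Uopen i j (Gsmooth k l) Ux).
have alg (a b c d e u v : R) : 2^-1 * (e + a - b) - u - (2^-1 * (e + c - d) - v) =
    2^-1 * (a - b - c + d) - u + v by ring.
exact: alg.
Qed.

Lemma ddmetricC i j k l x : U x -> pderiv i (dG j k l) x = pderiv i (dG j l k) x.
Proof.
by move=> Ux; apply: (pderiv_near Uopen _ Ux) => y; exact: dmetricC.
Qed.

Lemma riem4_antil i j k l x : riem4 G j i k l x = - riem4 G i j k l x.
Proof.
rewrite /riem4 -sumrN; apply: eq_bigr => m _.
rewrite -mulrN; congr (_ * _); rewrite /riem opprD !opprB -sumrN.
by congr (_ + _); apply: eq_bigr => a _; rewrite opprB.
Qed.

Lemma riem4_antir i j k l x : U x -> riem4 G i j l k x = - riem4 G i j k l x.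
Proof.
move=> Ux; rewrite (riem4E i j l k Ux) (riem4E i j k l Ux).
rewrite (quadchr_swap i l j k Ux) (quadchr_swap j l i k Ux).
rewrite (ddmetricC i k l j Ux) (ddmetricC i l j k Ux) (ddmetricC j k l i Ux).
rewrite (ddmetricC j l i k Ux).
have alg (a b c d u v : R) : 2^-1 * (b - a - d + c) - v + u =
    - (2^-1 * (a - b - c + d) - u + v) by ring.
exact: alg.
Qed.

Lemma riem4_pair i j k l x : U x -> riem4 G k l i j x = riem4 G i j k l x.
Proof.
move=> Ux; rewrite (riem4E k l i j Ux) (riem4E i j k l Ux).
rewrite (quadchrCl k i l j Ux) (quadchrCr i k l j Ux) (quadchr_swap l i k j Ux).
rewrite (quadchrCl k j l i Ux) (quadchrCr j k l i Ux).
rewrite (pderivC Uopen k j (Gsmooth i l) Ux) (pderivC Uopen k i (Gsmooth l j) Ux).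
rewrite (pderivC Uopen l j (Gsmooth i k) Ux) (pderivC Uopen l i (Gsmooth k j) Ux).
rewrite (ddmetricC i k l j Ux) (ddmetricC j l i k Ux).
have alg (a b c d u v : R) : 2^-1 * (d - b - c + a) - u + v =
    2^-1 * (a - b - c + d) - u + v by ring.
exact: alg.
Qed.

Lemma riem4_bianchi i j k l x : U x ->
  riem4 G i j k l x + riem4 G j k i l x + riem4 G k i j l x = 0.
Proof.
move=> Ux; rewrite (riem4E i j k l Ux) (riem4E j k i l Ux) (riem4E k i j l Ux).
rewrite (quadchrCl k i j l Ux) (quadchrCl k j i l Ux) (quadchrCl j i k l Ux).
rewrite (pderivC Uopen k i (Gsmooth j l) Ux) (pderivC Uopen k j (Gsmooth i l) Ux).
rewrite (pderivC Uopen j i (Gsmooth k l) Ux).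
rewrite (ddmetricC i l k j Ux) (ddmetricC j l k i Ux) (ddmetricC k l i j Ux).
have alg (a b c d e f u v w : R) :
    2^-1 * (a - b - c + d) - u + v + (2^-1 * (c - e - f + b) - w + u) +
    (2^-1 * (f - d - a + e) - v + w) = 0 by ring.
exact: alg.
Qed.
End RiemannSymmetries.

(** * Operators acting on one factor of a double form *)

Section DoubleFormOperators.
Variables (R : realType) (n : nat).
Implicit Types (A B : dform R n) (al be : eform R n) (f g : eform R n -> eform R n).
Implicit Types (s t : {set 'I_n} * {set 'I_n}) (a v : 'rV[R]_n) (i j k l : 'I_n).

Definition dbase s : dform R n := tens (ebase R s.1) (ebase R s.2).

Lemma tens_suml (I : finType) (F : I -> eform R n) be :
  tens (\sum_i F i) be = \sum_i tens (F i) be.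
Proof.
apply/ffunP => s; rewrite sum_ffunE ffunE sum_ffunE mulr_suml.
by apply: eq_bigr => i _; rewrite ffunE.
Qed.

Lemma tens_sumr (I : finType) (F : I -> eform R n) al :
  tens al (\sum_i F i) = \sum_i tens al (F i).
Proof.
apply/ffunP => s; rewrite sum_ffunE ffunE sum_ffunE mulr_sumr.
by apply: eq_bigr => i _; rewrite ffunE.
Qed.

Lemma tensZl c al be : tens (c *: al) be = c *: tens al be.
Proof. by apply/ffunP => s; rewrite !ffunE /GRing.scale /= mulrA. Qed.

Lemma tensZr c al be : tens al (c *: be) = c *: tens al be.
Proof. by apply/ffunP => s; rewrite !ffunE /GRing.scale /= mulrCA. Qed.

Lemma tensDl al al' be : tens (al + al') be = tens al be + tens al' be.
Proof. by apply/ffunP => s; rewrite !ffunE mulrDl. Qed.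

Lemma tensDr al be be' : tens al (be + be') = tens al be + tens al be'.
Proof. by apply/ffunP => s; rewrite !ffunE mulrDr. Qed.

Lemma dbaseE s t : dbase s t = (t == s)%:R.
Proof.
by rewrite !ffunE -natrM mulnb -pair_eqE.
Qed.

Lemma dformE A : A = \sum_s A s *: dbase s.
Proof.
apply/ffunP => t; rewrite sum_ffunE (bigD1 t)//= ffunE dbaseE eqxx big1 ?addr0.
  by rewrite /GRing.scale /= mulr1.
by move=> s st; rewrite ffunE dbaseE eq_sym (negPf st) scaler0.
Qed.

Lemma tensE al be : tens al be = \sum_s (al s.1 * be s.2) *: dbase s.
Proof. by rewrite [LHS]dformE; apply: eq_bigr => s _; rewrite ffunE. Qed.

Lemma on_left_is_linear f : linear (on_left f).
Proof.
move=> c A B; rewrite /on_left scaler_sumr -big_split; apply: eq_bigr => s _ /=.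
by rewrite !ffunE scalerA -scalerDl.
Qed.

Lemma on_right_is_linear f : linear (on_right f).
Proof.
move=> c A B; rewrite /on_right scaler_sumr -big_split; apply: eq_bigr => s _ /=.
by rewrite !ffunE scalerA -scalerDl.
Qed.

HB.instance Definition _ f := GRing.isLinear.Build R (dform R n) (dform R n) _
  (on_left f) (on_left_is_linear f).
HB.instance Definition _ f := GRing.isLinear.Build R (dform R n) (dform R n) _
  (on_right f) (on_right_is_linear f).

Lemma linear_ebase f al : linear f -> f al = \sum_I al I *: f (ebase R I).
Proof.
move=> fl; rewrite {1}(ebaseE al) (lin_sum fl).
by apply: eq_bigr => I _; rewrite (linZ fl).
Qed.

Lemma on_left_tens f al be : linear f -> on_left f (tens al be) = tens (f al) be.
Proof.
move=> fl; rewrite (linear_ebase al fl) tens_suml /on_left.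
rewrite [in RHS](ebaseE be).
under [RHS]eq_bigr do rewrite tens_sumr.
rewrite pair_bigA; apply: eq_bigr => -[I J] _ /=.
by rewrite ffunE tensZl tensZr scalerA.
Qed.

Lemma on_right_tens f al be : linear f -> on_right f (tens al be) = tens al (f be).
Proof.
move=> fl; rewrite (linear_ebase be fl) [in RHS](ebaseE al) tens_suml /on_right.
under [RHS]eq_bigr do rewrite tens_sumr.
rewrite pair_bigA; apply: eq_bigr => -[I J] _ /=.
by rewrite ffunE tensZl tensZr scalerA.
Qed.

(** Operators on the left factor compose like operators on forms; this and
    on_left_right reduce identities between operators on double forms to
    identities on the exterior algebra. *)
Lemma on_left_comp f g A : linear f -> on_left f (on_left g A) = on_left (f \o g) A.
Proof.
move=> fl; rewrite {2}/on_left linear_sum; apply: eq_bigr => s _ /=.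
by rewrite linearZ /= on_left_tens.
Qed.

Lemma on_right_comp f g A : linear f -> on_right f (on_right g A) = on_right (f \o g) A.
Proof.
move=> fl; rewrite {2}/on_right linear_sum; apply: eq_bigr => s _ /=.
by rewrite linearZ /= on_right_tens.
Qed.

Lemma on_left_right f g A : linear f -> linear g ->
  on_left f (on_right g A) = on_right g (on_left f A).
Proof.
move=> fl gl; rewrite /on_right {2}/on_left !linear_sum.
rewrite -/(on_right g _) linear_sum.
apply: eq_bigr => s _ /=.
by rewrite !linearZ /= on_left_tens// on_right_tens.
Qed.

Lemma eq_on_left f g : f =1 g -> on_left f =1 on_left g.
Proof. by move=> fg A; apply: eq_bigr => s _; rewrite fg. Qed.

Lemma eq_on_right f g : f =1 g -> on_right f =1 on_right g.
Proof. by move=> fg A; apply: eq_bigr => s _; rewrite fg. Qed.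

(** The composition formula on the left factor holds degree by degree, which is
    enough on a bihomogeneous double form. *)
Lemma eq_on_left_homog f g p q A : bihomogeneous p q A ->
  (forall al, homogeneous p al -> f al = g al) -> on_left f A = on_left g A.
Proof.
move=> hA fg; apply: eq_bigr => s _.
have [->|/hA[sp _]] := eqVneq (A s) 0; first by rewrite !scale0r.
rewrite fg// -sp; exact: homogeneous_base.
Qed.

Lemma on_left_sum (I : finType) (F : I -> eform R n -> eform R n) A :
  on_left (fun al => \sum_i F i al) A = \sum_i on_left (F i) A.
Proof.
rewrite /on_left exchange_big; apply: eq_bigr => s _ /=.
by rewrite tens_suml scaler_sumr.
Qed.

Lemma on_right_sum (I : finType) (F : I -> eform R n -> eform R n) A :
  on_right (fun al => \sum_i F i al) A = \sum_i on_right (F i) A.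
Proof.
rewrite /on_right exchange_big; apply: eq_bigr => s _ /=.
by rewrite tens_sumr scaler_sumr.
Qed.

Lemma on_leftZ c f A : on_left (fun al => c *: f al) A = c *: on_left f A.
Proof.
rewrite /on_left scaler_sumr; apply: eq_bigr => s _.
by rewrite tensZl !scalerA mulrC.
Qed.

Lemma on_rightZ c f A : on_right (fun al => c *: f al) A = c *: on_right f A.
Proof.
rewrite /on_right scaler_sumr; apply: eq_bigr => s _.
by rewrite tensZr !scalerA mulrC.
Qed.

Lemma on_leftD f g A : on_left (fun al => f al + g al) A = on_left f A + on_left g A.
Proof.
rewrite /on_left -big_split; apply: eq_bigr => s _.
by rewrite tensDl scalerDr.
Qed.

Lemma on_rightD f g A : on_right (fun al => f al + g al) A = on_right f A + on_right g A.
Proof.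
rewrite /on_right -big_split; apply: eq_bigr => s _.
by rewrite tensDr scalerDr.
Qed.

Lemma on_leftB f g A : on_left (fun al => f al - g al) A = on_left f A - on_left g A.
Proof.
rewrite on_leftD -scaleN1r -on_leftZ; congr (_ + _).
by apply: eq_on_left => al; rewrite scaleN1r.
Qed.

Lemma on_rightB f g A : on_right (fun al => f al - g al) A = on_right f A - on_right g A.
Proof.
rewrite on_rightD -scaleN1r -on_rightZ; congr (_ + _).
by apply: eq_on_right => al; rewrite scaleN1r.
Qed.

Lemma on_left_id A : on_left id A = A.
Proof. by rewrite [RHS]dformE. Qed.

Lemma on_right_id A : on_right id A = A.
Proof. by rewrite [RHS]dformE. Qed.

(** The elementary matrix (i, j) of gl_n, acting on forms as a derivation. *)
Definition elem i j al : eform R n := covwedge (cobase i) (insertion (cobase j) al).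

Lemma elem_linear i j : linear (elem i j).
Proof. by move=> c x y; rewrite /elem !linearP. Qed.

(** The commutation relations of the elementary matrices of gl_n. *)
Lemma elem_comm i j k l al : elem i j (elem k l al) - elem k l (elem i j al) =
  (j == k)%:R *: elem i l al - (l == i)%:R *: elem k j al.
Proof.
have E (a b c d : 'I_n) : elem a b (elem c d al) = (b == c)%:R *: elem a d al -
    covwedge (cobase a) (covwedge (cobase c)
      (insertion (cobase b) (insertion (cobase d) al))).
  by rewrite /elem ins_eps linearB linearZ.
rewrite !E (ins_ins j l) !(linearN (covwedge _)) eps_eps opprK.
by rewrite opprD addrACA subrr addr0.
Qed.

Definition delem i j A := on_left (elem i j) A + on_right (elem i j) A.

Lemma delem_is_linear i j : linear (delem i j).
Proof. by move=> c A B; rewrite /delem !linearP scalerDr addrACA. Qed.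

HB.instance Definition _ i j := GRing.isLinear.Build R (dform R n) (dform R n) _
  (delem i j) (delem_is_linear i j).

Lemma delem_comm i j k l A : delem i j (delem k l A) - delem k l (delem i j A) =
  (j == k)%:R *: delem i l A - (l == i)%:R *: delem k j A.
Proof.
have el := elem_linear.
have L : on_left (elem i j) (on_left (elem k l) A)
    - on_left (elem k l) (on_left (elem i j) A) =
    (j == k)%:R *: on_left (elem i l) A - (l == i)%:R *: on_left (elem k j) A.
  rewrite !on_left_comp// -!on_leftZ -!on_leftB.
  by apply: eq_on_left => al /=; rewrite elem_comm.
have Rt : on_right (elem i j) (on_right (elem k l) A)
    - on_right (elem k l) (on_right (elem i j) A) =
    (j == k)%:R *: on_right (elem i l) A - (l == i)%:R *: on_right (elem k j) A.
  rewrite !on_right_comp// -!on_rightZ -!on_rightB.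
  by apply: eq_on_right => al /=; rewrite elem_comm.
rewrite /delem.
rewrite !(linearD (on_left _)) !(linearD (on_right _)) /=.
rewrite  !(on_left_right _ (el _ _) (el _ _)) !scalerDr.
rewrite !opprD [RHS]addrACA -L -Rt.
move: (on_left _ (on_left _ _)) (on_left _ (on_left _ _)).
move: (on_right _ (on_right _ _)) (on_right _ (on_right _ _)).
move: (on_right _ (on_left _ _)) (on_right _ (on_left _ _)) => x y z t u w.
apply/ffunP => s; rewrite !ffunE /=; ring.
Qed.
End DoubleFormOperators.

(** * The curvature of the connection on double forms *)

Section CurvatureOperator.
Variables (R : realType) (n : nat) (U : set 'rV[R]_n) (G : 'rV[R]_n -> 'M[R]_n).
Hypothesis Uopen : open U.
Hypothesis Gsmooth : forall i j, smooth_on U (fun y => G y i j).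
Hypothesis Gsym : forall y, U y -> (G y)^T = G y.
Hypothesis Gunit : forall y, U y -> G y \in unitmx.
Variable om : 'rV[R]_n -> dform R n.
Hypothesis om_smooth : forall s, smooth_on U (fun y => om y s).
Implicit Types (x u v : 'rV[R]_n) (i j k l m : 'I_n) (p q : 'I_n * 'I_n).

Local Notation Gam := (christoffel G).

Definition dderiv k (om : 'rV[R]_n -> dform R n) x : dform R n :=
  [ffun s => pderiv k (fun y => om y s) x].

Local Notation N p := (delem p.1 p.2).
Local Notation Gm k p := (Gam p.2 k p.1).

(** The connection differs from the componentwise derivative by a gl_n-valued
    one-form with the Christoffel symbols as coefficients. *)
Lemma nablaE k (w : 'rV[R]_n -> dform R n) x :
  nabla G k w x = dderiv k w x - \sum_p Gm k p x *: N p (w x).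
Proof.
have connE al : conn G k x al = \sum_p (- Gm k p x) *: elem p.1 p.2 al.
  rewrite -(pair_bigA _ (fun i j => (- Gam j k i x) *: elem i j al)) exchange_big.
  apply: eq_bigr => j _ /=; rewrite covwedgeE; apply: eq_bigr => i _.
  by rewrite mxE.
rewrite /nabla -addrA; congr (_ + _).
rewrite (eq_on_left connE) (eq_on_right connE) on_left_sum on_right_sum.
rewrite -big_split -sumrN; apply: eq_bigr => p _ /=.
by rewrite on_leftZ on_rightZ -scalerDr scaleNr.
Qed.

(** An operator with constant coefficients acts on components by a fixed finite
    matrix, so it commutes with partial derivatives (pderiv_lin). *)
Lemma dform_linE (f : dform R n -> dform R n) A s : linear f ->
  f A s = \sum_t f (dbase R t) s * A t.
Proof.
move=> fl; pose lf : {linear dform R n -> dform R n} :=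
  HB.pack f (GRing.isLinear.Build R (dform R n) (dform R n) _ f fl).
rewrite {1}(dformE A) -[f]/(lf : _ -> _) linear_sum sum_ffunE.
by apply: eq_bigr => t _; rewrite linearZ ffunE /GRing.scale /= mulrC.
Qed.

Section ConstantCoefficients.
Variables (w : 'rV[R]_n -> dform R n) (k : 'I_n) (x : 'rV[R]_n).
Hypothesis dw : forall s, derivable (fun y => w y s) x (cobase k).
Variable f : dform R n -> dform R n.
Hypothesis fl : linear f.

Lemma derivable_lin s : derivable (fun y => f (w y) s) x (cobase k).
Proof.
under eq_fun do rewrite (dform_linE _ _ fl).
apply: derivable_bigsum => t _; apply: derivableM; [exact: derivable_cst|exact: dw].
Qed.

Lemma pderiv_lin s : pderiv k (fun y => f (w y) s) x = f (dderiv k w x) s.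
Proof.
under eq_fun do rewrite (dform_linE _ _ fl).
have dc t : derivable (fun y => f (dbase R t) s * w y t) x (cobase k).
  by apply: derivableM; [exact: derivable_cst|exact: dw].
rewrite /pderiv derive_bigsum// (dform_linE _ _ fl); apply: eq_bigr => t _.
rewrite ffunE /pderiv. apply: derive_cmul. exact: dw.
Qed.
End ConstantCoefficients.

Lemma om_derivable k s x : U x -> derivable (fun y => om y s) x (cobase k).
Proof. by move=> Ux; exact: smooth_derivable. Qed.

Lemma dderiv_nabla k l x : U x -> dderiv k (nabla G l om) x =
  dderiv k (dderiv l om) x - \sum_p pderiv k (Gm l p) x *: N p (om x)
  - \sum_p Gm l p x *: N p (dderiv k om x).
Proof.
move=> Ux; apply/ffunP => s.
have d1 : derivable (pderiv l (fun y => om y s)) x (cobase k).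
  by apply: smooth_derivable (Ux); exact: smooth_pderiv.
have d0 t : derivable (fun y => om y t) x (cobase k) by exact: om_derivable.
have d2 p : derivable (fun y => N p (om y) s) x (cobase k).
  exact: (derivable_lin d0 (@delem_is_linear R n p.1 p.2)).
have d3 p : derivable (Gm l p) x (cobase k).
  exact: (derivable_christoffel Uopen Gsmooth Gunit).
have d4 p : derivable (fun y => Gm l p y * N p (om y) s) x (cobase k).
  exact: (derivableM (d3 p) (d2 p)).
have -> : dderiv k (nabla G l om) x s = pderiv k
    (fun y => pderiv l (fun y => om y s) y - \sum_p Gm l p y * N p (om y) s) x.
  rewrite ffunE; congr (pderiv k _ x); apply/funext => y.
  rewrite nablaE !ffunE sum_ffunE; congr (_ - _).
  by apply: eq_bigr => p _; rewrite ffunE.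
have d5 : derivable (fun y => \sum_p Gm l p y * N p (om y) s) x (cobase k).
  by apply: derivable_bigsum => p _; exact: d4.
apply: etrans (derive_sub d1 d5) _.
rewrite [RHS]ffunE [X in _ = X + _]ffunE.
rewrite [X in _ = _ + X + _]ffunE [X in _ = _ + _ + X]ffunE !sum_ffunE.
rewrite -[RHS]addrA -opprD -big_split; congr (_ - _).
  by rewrite ffunE; congr (pderiv k _ x); apply/funext => y; rewrite ffunE.
apply: etrans; first by apply: derive_bigsum => p _; exact: d4.
apply: eq_bigr => p _ /=; apply: etrans (derive_mul (d3 p) (d2 p)) _.
rewrite [X in _ = X + _]ffunE [X in _ = _ + X]ffunE.
congr (_ + _ * _); exact: (pderiv_lin d0 (@delem_is_linear R n p.1 p.2)).
Qed.

Lemma dderivC k l x : U x -> dderiv k (dderiv l om) x = dderiv l (dderiv k om) x.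
Proof.
have dE a w s : dderiv a w x s = pderiv a (fun y => w y s) x by rewrite ffunE.
move=> Ux; apply/ffunP => s; apply: etrans (dE k _ s) (etrans _ (esym (dE l _ s))).
have E a : (fun y => dderiv a om y s) = pderiv a (fun y => om y s).
  by apply/funext => y; rewrite ffunE.
by rewrite (E l) (E k); exact: (pderivC Uopen).
Qed.

(** Evaluates one of the two terms of delem_comm in a double sum: the
    coefficients multiply like matrices. *)
Lemma sum_contract (c d : 'I_n -> 'I_n -> R) (M : 'I_n -> 'I_n -> dform R n) :
  \sum_p \sum_q (c p.1 p.2 * d q.1 q.2) *: ((p.2 == q.1)%:R *: M p.1 q.2) =
  \sum_a \sum_m (\sum_b c a b * d b m) *: M a m.
Proof.
rewrite -(pair_bigA _ (fun i j => \sum_q (c i j * d q.1 q.2) *: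
  ((j == q.1)%:R *: M i q.2))) /=; apply: eq_bigr => i _.
under [RHS]eq_bigr do rewrite scaler_suml.
rewrite [RHS]exchange_big /=; apply: eq_bigr => j _.
rewrite -(pair_bigA _ (fun a b => (c i j * d a b) *: ((j == a)%:R *: M i b))) /=.
rewrite (bigD1 j)//= [X in _ + X]big1 ?addr0 => [|a aj].
  by apply: eq_bigr => b _; rewrite eqxx scale1r.
by rewrite big1// => b _; rewrite eq_sym (negPf aj) scale0r scaler0.
Qed.

(** Of the second covariant derivative, the second partial derivatives and the
    terms with one derivative of the form are symmetric in k and l.  What is left
    is the derivative of the connection coefficients and, by delem_comm, their
    commutator: the Riemann tensor acting as a derivation. *)
Lemma nabla_comm k l x : U x ->
  nabla G k (nabla G l om) x - nabla G l (nabla G k om) x =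
  - \sum_a \sum_m riem G m a k l x *: delem a m (om x).
Proof.
move=> Ux.
(* T is symmetric, P collects the derivatives of the coefficients and S is
   quadratic in them *)
pose T k l := dderiv k (dderiv l om) x - \sum_p Gm l p x *: N p (dderiv k om x)
   - \sum_p Gm k p x *: N p (dderiv l om x).
pose P k l := \sum_p pderiv k (Gm l p) x *: N p (om x).
pose S k l := \sum_p \sum_q (Gm k p x * Gm l q x) *: N p (N q (om x)).
have E a b : nabla G a (nabla G b om) x = T a b - P a b + S a b.
  rewrite nablaE dderiv_nabla// nablaE.
  have -> : \sum_p Gm a p x *: N p (dderiv b om x - \sum_q Gm b q x *: N q (om x))
      = \sum_p Gm a p x *: N p (dderiv b om x) - S a b.
    rewrite -sumrB; apply: eq_bigr => p _.
    rewrite linearB scalerBr linear_sum scaler_sumr; congr (_ - _).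
    by apply: eq_bigr => q _; rewrite linearZ scalerA.
  have alg (d w y z t : dform R n) : d - w - y - (z - t) = d - y - z - w + t.
    by apply/ffunP => s; rewrite !ffunE; ring.
  exact: alg.
have TC : T k l = T l k.
  by have D := dderivC k l Ux; rewrite /T D; exact: addrAC.
rewrite !E TC.
transitivity (S k l - S l k - (P k l - P l k)).
  have alg (d y z t u : dform R n) : d - y + z - (d - t + u) = z - u - (y - t).
    by apply/ffunP => s; rewrite !ffunE; ring.
  exact: alg.
have -> : S k l - S l k = \sum_p \sum_q (Gm k p x * Gm l q x) *:
    ((p.2 == q.1)%:R *: delem p.1 q.2 (om x) - (q.2 == p.1)%:R *: delem q.1 p.2 (om x)).
  rewrite [S l k]exchange_big -sumrB; apply: eq_bigr => p _ /=.
  rewrite -sumrB; apply: eq_bigr => q _ /=.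
  by rewrite [Gm l q x * _]mulrC -scalerBr delem_comm.
have -> : \sum_p \sum_q (Gm k p x * Gm l q x) *:
    ((p.2 == q.1)%:R *: delem p.1 q.2 (om x) - (q.2 == p.1)%:R *: delem q.1 p.2 (om x))
  = \sum_a \sum_m (\sum_b Gam b k a x * Gam m l b x) *: delem a m (om x)
    - \sum_a \sum_m (\sum_b Gam b l a x * Gam m k b x) *: delem a m (om x).
  rewrite -(sum_contract (fun i j => Gam j k i x) (fun i j => Gam j l i x)
    (fun i j => delem i j (om x))).
  rewrite -(sum_contract (fun i j => Gam j l i x) (fun i j => Gam j k i x)
    (fun i j => delem i j (om x))).
  rewrite [X in _ - X]exchange_big -sumrB; apply: eq_bigr => p _ /=.
  rewrite -sumrB; apply: eq_bigr => q _ /=.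
  by rewrite scalerBr [(Gam q.2 l q.1 x * _)]mulrC.
have -> : P k l - P l k = \sum_a \sum_m
    (pderiv k (Gam m l a) x - pderiv l (Gam m k a) x) *: delem a m (om x).
  rewrite -sumrB pair_bigA; apply: eq_bigr => p _ /=.
  by rewrite scalerBl.
rewrite -!sumrB -sumrN; apply: eq_bigr => a _.
rewrite -!sumrB -sumrN; apply: eq_bigr => m _.
rewrite -!scalerBl -scaleNr; congr (_ *: _).
rewrite /riem [RHS]opprD [RHS]addrC; congr (_ - _).
rewrite -sumrB -sumrN; apply: eq_bigr => b _.
by rewrite opprB; congr (_ - _); rewrite mulrC.
Qed.

(** The correction term of nabla2 cancels because the connection is
    torsion-free. *)
Lemma curv_opE u v x : U x -> curv_op G u v om x =
  - \sum_k \sum_l (v 0 k * u 0 l) *: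
      \sum_a \sum_m riem G m a k l x *: delem a m (om x).
Proof.
move=> Ux; rewrite /curv_op /nabla2 [X in _ - X]exchange_big -sumrB -sumrN.
apply: eq_bigr => k _; rewrite -sumrB -sumrN; apply: eq_bigr => l _ /=.
rewrite [u 0 l * _]mulrC -scalerBr -scalerN; congr (_ *: _).
rewrite -nabla_comm//.
have -> : \sum_m Gam m l k x *: nabla G m om x = \sum_m Gam m k l x *: nabla G m om x.
  by apply: eq_bigr => m _; rewrite (christoffelC Uopen Gsym m l k Ux).
by rewrite opprB addrA subrK.
Qed.
End CurvatureOperator.

(** * Wedge and inner products by induction on monomials *)

Section MonomialInduction.
Variables (R : realType) (n : nat).
Implicit Types (al be : eform R n) (i j k : 'I_n) (I J : {set 'I_n}).
Local Notation eps i := (covwedge (cobase i)).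
Local Notation one := (ebase R set0 : eform R n).

Lemma eps_ebase i I :
  eps i (ebase R I) = ((i \notin I)%:R * esgn R i I) *: ebase R (i |: I).
Proof.
apply/ffunP => J; rewrite epsE !ffunE /GRing.scale /=.
have [iJ|iJ] := boolP (i \in J); last first.
  rewrite mul0r; case: eqVneq => [E|_]; last by rewrite mulr0.
  by rewrite E setU11 in iJ.
rewrite mul1r; have [iI|iI] /= := boolP (i \in I).
  rewrite !mul0r; case: eqVneq => [E|_]; last by rewrite mulr0.
  by rewrite -E setD11 in iI.
rewrite mul1r; case: (eqVneq J (i |: I)) => [->|JI].
  by rewrite setU1K// eqxx esgnU// ltnn mul1r.
rewrite mulr0; case: eqVneq => [E|_]; last by rewrite mulr0.
by rewrite -E setD1K// eqxx in JI.
Qed.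

Lemma notin_above i I : (forall j, j \in I -> (i < j)%N) -> i \notin I.
Proof. by move=> iI; apply/negP => /iI; rewrite ltnn. Qed.

(** Adding a new smallest index costs no sign: it is the only case in which the
    enumeration of the index set simply grows by its head, and the reason for
    the induction principle eform_ind. *)
Lemma ebase_above i I : (forall j, j \in I -> (i < j)%N) ->
  eps i (ebase R I) = ebase R (i |: I).
Proof.
move=> iI; rewrite eps_ebase notin_above// mul1r /esgn.
rewrite (_ : [set j in I | (j < i)%N] = set0) ?cards0 ?expr0 ?scale1r//.
apply/setP => j; rewrite !inE; apply/negP => /andP[/iI ij ji].
by have := ltn_trans ij ji; rewrite ltnn.
Qed.

Lemma enum_above i I : (forall j, j \in I -> (i < j)%N) ->
  enum (i |: I) = i :: enum I.
Proof.
move=> iI; pose lt (a b : 'I_n) := (a < b)%N.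
have lt_tr : transitive lt by move=> a b c; exact: ltn_trans.
have lt_irr : irreflexive lt by move=> a; exact: ltnn.
have so J : sorted lt (enum J).
  rewrite {1}/enum_mem; apply: sorted_filter => //.
  rewrite -enumT; have := iota_ltn_sorted 0 n; rewrite -val_enum_ord.
  by rewrite sorted_map.
apply: (irr_sorted_eq lt_tr lt_irr) => //.
  rewrite /= path_min_sorted ?so//; apply/allP => j.
  by rewrite mem_enum => /iI.
by move=> j; rewrite inE !mem_enum !inE.
Qed.

Lemma set_ind_above (P : {set 'I_n} -> Prop) : P set0 ->
  (forall i I, (forall j, j \in I -> (i < j)%N) -> P I -> P (i |: I)) ->
  forall I, P I.
Proof.
move=> P0 PU I; have [m] := ubnP #|I|; elim: m I => // m IH I /ltnSE Im.
have [->//|[i0 i0I]] := set_0Vmem I.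
pose i := [arg min_(i < i0 in I) (i : nat)].
have [iI imin] : i \in I /\ forall j, j \in I -> (i <= j)%N.
  by rewrite /i; case: arg_minnP.
rewrite -(setD1K iI); apply: PU => [j|].
  rewrite !inE => /andP[ji /imin]; rewrite leq_eqVlt => /orP[|//].
  by move=> /eqP/val_inj E; rewrite E eqxx in ji.
by apply: IH; rewrite (cardsD1 i) iI in Im.
Qed.

(** Monomials are built from 1 by exterior multiplications with decreasing
    indices. *)
Lemma eform_ind (P : eform R n -> Prop) :
  (forall c al be, P al -> P be -> P (c *: al + be)) -> P one ->
  (forall i I, (forall j, j \in I -> (i < j)%N) ->
     P (ebase R I) -> P (eps i (ebase R I))) ->
  forall al, P al.
Proof.
move=> PD P1 Pe al.
have P0 : P 0 by rewrite -(subrr one) -scaleN1r addrC; apply: PD.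
have PI : forall I, P (ebase R I).
  apply: set_ind_above => // i I iI; rewrite -ebase_above//; exact: Pe.
rewrite (ebaseE al); elim/big_rec: _ => // I x _; exact: PD.
Qed.

Lemma covwedgeZ c (a : 'rV[R]_n) al : covwedge a (c *: al) = c *: covwedge a al.
Proof. exact: linearZ_LR. Qed.

Lemma insertionZ c (v : 'rV[R]_n) al : insertion v (c *: al) = c *: insertion v al.
Proof. exact: linearZ_LR. Qed.

Lemma eps_eps0 i al : eps i (eps i al) = 0.
Proof.
apply/ffunP => J; rewrite !epsE !inE eqxx /= ffunE.
by rewrite mul0r !mulr0.
Qed.

End MonomialInduction.

Section WedgeInner.
Variables (R : realType) (n : nat) (G : 'M[R]_n).
Hypothesis Gsym : G^T = G.
Implicit Types (al be : eform R n) (i j k : 'I_n) (I J : {set 'I_n}).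
Local Notation eps i := (covwedge (cobase i)).
Local Notation insG i := (insertion (sharp G (cobase i))).
Local Notation one := (ebase R set0 : eform R n).

Lemma sum_ebase (V : lmodType R) (F : {set 'I_n} -> V) I :
  \sum_J ebase R I J *: F J = F I.
Proof.
rewrite (bigD1 I)//= ffunE eqxx scale1r big1 ?addr0// => J JI.
by rewrite ffunE (negPf JI) scale0r.
Qed.

Lemma ewedge_ebase I be :
  ewedge (ebase R I) be = foldr (fun i => eps i) be (enum I).
Proof. exact: (sum_ebase (fun I => foldr (fun i => eps i) be (enum I))). Qed.

Lemma ewedge_linearl be : linear (fun x => ewedge x be).
Proof.
move=> c x y; rewrite /ewedge scaler_sumr -big_split; apply: eq_bigr => I _ /=.
by rewrite !ffunE scalerDl scalerA.
Qed.

Lemma ewedge_linearr al : linear (ewedge al).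
Proof.
move=> c x y; rewrite /ewedge scaler_sumr -big_split; apply: eq_bigr => I _ /=.
have -> : foldr (fun i => eps i) (c *: x + y) (enum I) =
    c *: foldr (fun i => eps i) x (enum I) + foldr (fun i => eps i) y (enum I).
  by elim: (enum I) => //= i s ->; rewrite linearP.
by rewrite scalerDr !scalerA mulrC.
Qed.

Lemma ewedge1 be : ewedge one be = be.
Proof. by rewrite ewedge_ebase enum_set0. Qed.

Lemma ewedge_above i I be : (forall j, j \in I -> (i < j)%N) ->
  ewedge (eps i (ebase R I)) be = eps i (ewedge (ebase R I) be).
Proof. by move=> iI; rewrite ebase_above// !ewedge_ebase enum_above. Qed.

(** By definition this holds when i is below all indices of the monomial.
    Otherwise the smallest index of the monomial is exchanged with i, since
    exterior multiplications anticommute. *)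
Lemma ewedge_eps i al be : ewedge (eps i al) be = eps i (ewedge al be).
Proof.
move: al i be; apply: eform_ind => [c x y hx hy i be||m I mI IH i be].
- by rewrite linearP !ewedge_linearl hx hy linearP.
- by move=> i be; rewrite ewedge_above// => j; rewrite inE.
have [im|mi|/val_inj ->] := ltngtP i m.
- rewrite [eps m _]ebase_above// ewedge_above// => j.
  by rewrite !inE => /orP[/eqP->//|/mI]; exact: ltn_trans.
- rewrite eps_eps (linN (ewedge_linearl be)) ewedge_above//.
  rewrite (eps_eps i m (ewedge _ _)) -IH eps_ebase covwedgeZ.
  rewrite !(linZ (ewedge_linearl be)) covwedgeZ ewedge_above//.
  move=> j; rewrite !inE => /orP[/eqP->//|]; exact: mI.
- by rewrite eps_eps0 (lin0 (ewedge_linearl be)) ewedge_above// eps_eps0.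
Qed.

Lemma ebase1 i : ebase R [set i] = eps i one.
Proof. by rewrite ebase_above ?setU0// => j; rewrite inE. Qed.

Lemma ebase2 i j : (i < j)%N -> ebase R [set i; j] = eps i (eps j one).
Proof.
by move=> ij; rewrite -ebase1 ebase_above// => k; rewrite inE => /eqP->.
Qed.

Lemma ewedge_covector a be : ewedge (covector a) be = covwedge a be.
Proof.
rewrite covwedgeE (lin_sum (ewedge_linearl be)); apply: eq_bigr => i _.
by rewrite (linZ (ewedge_linearl be)) ebase1 ewedge_eps ewedge1.
Qed.

Lemma einner_ebase I be : einner G (ebase R I) be =
  foldl (fun x i => insG i x) be (enum I) set0.
Proof.
exact: (sum_ebase (fun I => foldl (fun x i => insG i x) be (enum I) set0 : R^o)).
Qed.

Lemma einner_linearl be c x y :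
  einner G (c *: x + y) be = c * einner G x be + einner G y be.
Proof.
rewrite /einner mulr_sumr -big_split; apply: eq_bigr => I _ /=.
by rewrite !ffunE mulrDl mulrA.
Qed.

Lemma einner_linearr al c x y :
  einner G al (c *: x + y) = c * einner G al x + einner G al y.
Proof.
rewrite /einner mulr_sumr -big_split; apply: eq_bigr => I _ /=.
have -> : foldl (fun x i => insG i x) (c *: x + y) (enum I) =
    c *: foldl (fun x i => insG i x) x (enum I) + foldl (fun x i => insG i x) y (enum I).
  by elim: (enum I) x y => //= i s IH x y; rewrite linearP IH.
by rewrite !ffunE /GRing.scale /=; ring.
Qed.

Lemma einner1 be : einner G one be = be set0.
Proof. by rewrite einner_ebase enum_set0. Qed.

Lemma einner_above i I be : (forall j, j \in I -> (i < j)%N) ->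
  einner G (eps i (ebase R I)) be = einner G (ebase R I) (insG i be).
Proof. by move=> iI; rewrite ebase_above// !einner_ebase enum_above. Qed.

Lemma eps_set0 i al : eps i al set0 = 0.
Proof. by rewrite epsE inE mul0r. Qed.

Lemma ins_one v : insertion v one = 0 :> eform R n.
Proof.
by apply: homogeneous_ins0; have := @homogeneous_base R n set0; rewrite cards0.
Qed.

Lemma einner0l be : einner G 0 be = 0.
Proof. by rewrite /einner big1// => I _; rewrite ffunE mul0r. Qed.

Lemma einner0r al : einner G al 0 = 0.
Proof. by have := einner_linearr al (-1) 0 0; rewrite scaler0 addr0 mulN1r addNr. Qed.

Lemma einnerZl c al be : einner G (c *: al) be = c * einner G al be.
Proof. by rewrite -[c *: al]addr0 einner_linearl einner0l addr0. Qed.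

Lemma einnerZr c al be : einner G al (c *: be) = c * einner G al be.
Proof. by rewrite -[c *: be]addr0 einner_linearr einner0r addr0. Qed.

Lemma einnerNr al be : einner G al (- be) = - einner G al be.
Proof. by rewrite -[- be]addr0 -scaleN1r einner_linearr einner0r addr0 mulN1r. Qed.

Lemma einnerNl al be : einner G (- al) be = - einner G al be.
Proof. by rewrite -scaleN1r einnerZl mulN1r. Qed.

Lemma insG_insG0 i be : insG i (insG i be) = 0.
Proof.
have : 2%:R *: insG i (insG i be) = 0.
  by rewrite scaler_nat mulr2n {1}insertion_insertion addNr.
by move/eqP; rewrite scaler_eq0 pnatr_eq0 => /eqP.
Qed.

(** The same exchange argument as for ewedge_eps, with the insertions of the
    definition in place of the exterior multiplications. *)
Lemma einner_epsl i al be : einner G (eps i al) be = einner G al (insG i be).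
Proof.
move: al i be; apply: eform_ind => [c x y hx hy i be||m I mI IH i be].
- by rewrite linearP !einner_linearl hx hy.
- by move=> i be; rewrite einner_above// => j; rewrite inE.
have [im|mi|/val_inj ->] := ltngtP i m.
- rewrite [eps m _]ebase_above// einner_above// => j.
  by rewrite !inE => /orP[/eqP->//|/mI]; exact: ltn_trans.
- rewrite eps_eps einnerNl einner_above// insertion_insertion einnerNr -IH.
  rewrite eps_ebase covwedgeZ !einnerZl /= einner_above//.
  move=> j; rewrite !inE => /orP[/eqP->//|]; exact: mI.
- by rewrite eps_eps0 einner0l einner_above// insG_insG0 einner0r.
Qed.

(** Adjointness in the other argument.  It follows from einner_epsl and the
    anticommutator of insG and eps, which is symmetric, by induction on al. *)
Lemma einner_epsr i al be : einner G al (eps i be) = einner G (insG i al) be.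
Proof.
move: al be; apply: eform_ind => [c x y hx hy be|be|m I mI IH be].
- by rewrite linearP !einner_linearl hx hy.
- by rewrite einner1 eps_set0 ins_one einner0l.
have E x v y : einner G (x - y) v = einner G x v - einner G y v.
  by rewrite addrC -scaleN1r einner_linearl mulN1r addrC.
have E' x v y : einner G v (x - y) = einner G v x - einner G v y.
  by rewrite addrC -scaleN1r einner_linearr mulN1r addrC.
rewrite einner_epsl !insertion_covwedge E E' IH einner_epsl einnerZl einnerZr.
by congr (_ * _ - _); exact: (ipC Gsym).
Qed.
End WedgeInner.

(** * Products of double forms, and the action by composition *)

Section BilinearExtension.
Variables (R : realType) (n : nat).
Implicit Types (A B : dform R n) (al be : eform R n).
Variable F : eform R n -> eform R n -> eform R n -> eform R n -> dform R n.

Lemma bilin_ext_linearl B : linear (fun A => bilin_ext F A B).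
Proof.
move=> c x y; rewrite /bilin_ext scaler_sumr -big_split; apply: eq_bigr => s _ /=.
rewrite scaler_sumr -big_split; apply: eq_bigr => t _ /=.
by rewrite !ffunE scalerA -scalerDl mulrDl mulrA.
Qed.

Lemma bilin_ext_linearr A : linear (bilin_ext F A).
Proof.
move=> c x y; rewrite /bilin_ext scaler_sumr -big_split; apply: eq_bigr => s _ /=.
rewrite scaler_sumr -big_split; apply: eq_bigr => t _ /=.
by rewrite !ffunE scalerA -scalerDl mulrDr mulrCA.
Qed.

HB.instance Definition _ A := GRing.isLinear.Build R (dform R n) (dform R n) _
  (bilin_ext F A) (bilin_ext_linearr A).

Lemma sum_dbase (V : lmodType R) (H : {set 'I_n} * {set 'I_n} -> V) s :
  \sum_t dbase R s t *: H t = H s.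
Proof.
rewrite (bigD1 s)//= dbaseE eqxx scale1r big1 ?addr0// => t ts.
by rewrite dbaseE (negPf ts) scale0r.
Qed.

Lemma bilin_ext_dbasel s B : bilin_ext F (dbase R s) B =
  \sum_t B t *: F (ebase R s.1) (ebase R s.2) (ebase R t.1) (ebase R t.2).
Proof.
rewrite /bilin_ext.
under eq_bigr do (under eq_bigr do rewrite -scalerA; rewrite -scaler_sumr).
exact: (sum_dbase (fun s => \sum_t B t *: F (ebase R s.1) (ebase R s.2) _ _)).
Qed.

Lemma bilin_ext_dbase s t : bilin_ext F (dbase R s) (dbase R t) =
  F (ebase R s.1) (ebase R s.2) (ebase R t.1) (ebase R t.2).
Proof.
by rewrite bilin_ext_dbasel
  (sum_dbase (fun t => F _ _ (ebase R t.1) (ebase R t.2))).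
Qed.
End BilinearExtension.

Section DoubleFormProducts.
Variables (R : realType) (n : nat).
Implicit Types (A B : dform R n) (al be : eform R n) (i j k l : 'I_n).
Local Notation eps i := (covwedge (cobase i)).
Local Notation ins i := (insertion (cobase i)).
Local Notation one := (ebase R set0 : eform R n).

Lemma dform_ind (P : dform R n -> Prop) :
  (forall c A B, P A -> P B -> P (c *: A + B)) -> (forall s, P (dbase R s)) ->
  forall A, P A.
Proof.
move=> PD Pb A.
have P0 : P 0.
  by rewrite -(subrr (dbase R (set0, set0))) -scaleN1r addrC; apply: PD.
by rewrite (dformE A); elim/big_rec: _ => // s x _; exact: PD.
Qed.

Lemma eq_dform_linear (f g : dform R n -> dform R n) : linear f -> linear g ->
  (forall s, f (dbase R s) = g (dbase R s)) -> f =1 g.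
Proof.
move=> fl gl fg; apply: dform_ind => // c A B fA fB.
by rewrite fl gl fA fB.
Qed.

Lemma dfwedge_ebase s B : dfwedge (dbase R s) B =
  on_left (ewedge (ebase R s.1)) (on_right (ewedge (ebase R s.2)) B).
Proof.
have lr := @ewedge_linearr R n.
move: B; apply: eq_dform_linear => [c x y|c x y|t].
- exact: bilin_ext_linearr.
- by rewrite !linearP.
- by rewrite [LHS]bilin_ext_dbase /dbase on_right_tens// on_left_tens.
Qed.

Lemma dfwedge_one B : dfwedge dfone B = B.
Proof.
rewrite [dfwedge _ _](dfwedge_ebase (set0, set0)) /=.
rewrite (eq_on_left (@ewedge1 R n)) (eq_on_right (@ewedge1 R n)).
by rewrite on_left_id on_right_id.
Qed.

Lemma dlin_sum (f : dform R n -> dform R n) : linear f ->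
  forall (I : Type) (r : seq I) (P : pred I) (F : I -> dform R n),
  f (\sum_(i <- r | P i) F i) = \sum_(i <- r | P i) f (F i).
Proof.
move=> fl I r P F; pose lf : {linear dform R n -> dform R n} :=
  HB.pack f (GRing.isLinear.Build R (dform R n) (dform R n) _ f fl).
exact: (linear_sum lf).
Qed.

Lemma dlinZ (f : dform R n -> dform R n) : linear f ->
  forall c A, f (c *: A) = c *: f A.
Proof.
move=> fl c A; pose lf : {linear dform R n -> dform R n} :=
  HB.pack f (GRing.isLinear.Build R (dform R n) (dform R n) _ f fl).
exact: (linearZ_LR lf).
Qed.

Lemma dfwedge_linearl B : linear (fun A => dfwedge A B).
Proof. exact: bilin_ext_linearl. Qed.

Lemma dfwedge_linearr A : linear (dfwedge A).
Proof. exact: bilin_ext_linearr. Qed.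

Lemma dfwedge_tens al be ga de :
  dfwedge (tens al be) (tens ga de) = tens (ewedge al ga) (ewedge be de).
Proof.
have lr := @ewedge_linearr R n.
rewrite (tensE al be) (dlin_sum (dfwedge_linearl _)).
rewrite (linear_ebase al (ewedge_linearl ga)) (linear_ebase be (ewedge_linearl de)).
rewrite tens_suml; under [RHS]eq_bigr do rewrite tens_sumr.
rewrite [RHS]pair_bigA; apply: eq_bigr => -[I J] _ /=.
rewrite (dlinZ (dfwedge_linearl _)) dfwedge_ebase on_right_tens// on_left_tens//.
by rewrite tensZl tensZr scalerA.
Qed.

(** Associativity of the product of double forms when the first factor is a
    (1,1) form of rank one, in operator form. *)
Lemma dfwedge_eps i j A B :
  dfwedge (on_left (eps i) (on_right (eps j) A)) B =
  on_left (eps i) (on_right (eps j) (dfwedge A B)).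
Proof.
have le k : linear (eps k : eform R n -> eform R n) by exact: covwedge_linear.
move: A B; apply: dform_ind => [c x y hx hy B|s].
  rewrite (linearP (on_right _)) (linearP (on_left _)).
  by rewrite !dfwedge_linearl hx hy (linearP (on_right _)) (linearP (on_left _)).
apply: dform_ind => [c x y hx hy|t].
  rewrite !dfwedge_linearr hx hy.
  by rewrite (linearP (on_right _)) (linearP (on_left _)).
rewrite !(dfwedge_tens, on_right_tens, on_left_tens)//.
by rewrite !ewedge_eps.
Qed.

Lemma dfwedge_covl a B :
  dfwedge (tens (covector a) one) B = on_left (covwedge a) B.
Proof.
have la : linear (covwedge a : eform R n -> eform R n) by exact: covwedge_linear.
move: B; apply: dform_ind => [c x y hx hy|t].
  by rewrite dfwedge_linearr hx hy linearP.
by rewrite dfwedge_tens on_left_tens// ewedge_covector ewedge1.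
Qed.

Lemma dfwedge_bilform (H : 'M[R]_n) B : dfwedge (bilform H) B =
  \sum_i \sum_j H i j *: on_left (eps i) (on_right (eps j) B).
Proof.
rewrite (dlin_sum (dfwedge_linearl B)); apply: eq_bigr => i _.
rewrite (dlin_sum (dfwedge_linearl B)); apply: eq_bigr => j _.
rewrite (dlinZ (dfwedge_linearl B)) !ebase1; congr (_ *: _).
have le k : linear (eps k : eform R n -> eform R n) by exact: covwedge_linear.
by rewrite -on_left_tens// -on_right_tens// dfwedge_eps [dfwedge _ _]dfwedge_one.
Qed.

Lemma dfwedge_bilformA (H : 'M[R]_n) A B :
  dfwedge (dfwedge (bilform H) A) B = dfwedge (bilform H) (dfwedge A B).
Proof.
rewrite !dfwedge_bilform (dlin_sum (dfwedge_linearl B)); apply: eq_bigr => i _.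
rewrite (dlin_sum (dfwedge_linearl B)); apply: eq_bigr => j _.
by rewrite (dlinZ (dfwedge_linearl B)) dfwedge_eps.
Qed.

End DoubleFormProducts.

Section Composition.
Variables (R : realType) (n : nat) (G : 'M[R]_n).
Hypothesis Gsym : G^T = G.
Hypothesis Gunit : G \in unitmx.
Implicit Types (A B : dform R n) (al be : eform R n) (i j k l : 'I_n).
Local Notation eps i := (covwedge (cobase i)).
Local Notation ins i := (insertion (cobase i)).
Local Notation insG i := (insertion (sharp G (cobase i))).
Local Notation one := (ebase R set0 : eform R n).

(** Composition with B acts on the left factor only; this is the operator by
    which it acts there. *)
Definition comp_act B al : eform R n :=
  \sum_t (B t * einner G al (ebase R t.2)) *: ebase R t.1.

Lemma dfcompE A B : dfcomp G A B = on_left (comp_act B) A.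
Proof.
apply: eq_bigr => s _; rewrite /comp_act tens_suml scaler_sumr.
by apply: eq_bigr => t _; rewrite tensZl !scalerA mulrA.
Qed.

Lemma comp_act_linear B : linear (comp_act B).
Proof.
move=> c x y; rewrite /comp_act scaler_sumr -big_split; apply: eq_bigr => t _ /=.
by rewrite einner_linearl mulrDr scalerDl scalerA mulrCA.
Qed.

Lemma comp_act_linearl al c A B :
  comp_act (c *: A + B) al = c *: comp_act A al + comp_act B al.
Proof.
rewrite /comp_act scaler_sumr -big_split; apply: eq_bigr => t _ /=.
by rewrite !ffunE mulrDl scalerDl scalerA /GRing.scale /= mulrA.
Qed.

Lemma comp_act_sum al (I : finType) (F : I -> dform R n) :
  comp_act (\sum_i F i) al = \sum_i comp_act (F i) al.
Proof.
rewrite /comp_act exchange_big; apply: eq_bigr => t _ /=.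
by rewrite sum_ffunE mulr_suml scaler_suml.
Qed.

Lemma comp_actZ al c A : comp_act (c *: A) al = c *: comp_act A al.
Proof.
rewrite /comp_act scaler_sumr; apply: eq_bigr => t _.
by rewrite !ffunE scalerA /GRing.scale /= mulrA.
Qed.

Lemma comp_act_tens be ga al : comp_act (tens be ga) al = einner G al ga *: be.
Proof.
rewrite [in RHS](ebaseE be) [in RHS](ebaseE ga).
have -> : einner G al (\sum_I ga I *: ebase R I) =
    \sum_I ga I * einner G al (ebase R I).
  elim/big_rec2: _ => [|I y1 y2 _ <-]; first by rewrite einner0r.
  by rewrite einner_linearr.
rewrite scaler_sumr; under [RHS]eq_bigr do rewrite scalerA mulr_suml scaler_suml.
rewrite [RHS]pair_bigA; apply: eq_bigr => -[I J] _ /=.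
by rewrite ffunE /= -!mulrA [einner _ _ _ * _]mulrC [be I * _]mulrCA.
Qed.

(** By adjointness, exterior multiplication in the right factor of B becomes an
    insertion in the argument. *)
Lemma comp_act_eps i j B al :
  comp_act (on_left (eps i) (on_right (eps j) B)) al = eps i (comp_act B (insG j al)).
Proof.
have le k : linear (eps k : eform R n -> eform R n) by exact: covwedge_linear.
move: B; apply: dform_ind => [c x y hx hy|s].
  rewrite (linearP (on_right _)) (linearP (on_left _)) !comp_act_linearl hx hy.
  by rewrite linearP.
rewrite on_right_tens// on_left_tens// !comp_act_tens covwedgeZ.
by rewrite (einner_epsr Gsym).
Qed.

(** Lowering the index of a dual vector gives back the coordinate vector. *)
Lemma sum_metric_sharp i al : \sum_j G i j *: insG j al = ins i al.
Proof.
rewrite insertionE.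
under eq_bigr do rewrite insertionE scaler_sumr.
rewrite exchange_big; apply: eq_bigr => k _ /=.
under eq_bigr do rewrite scalerA; rewrite -scaler_suml; congr (_ *: _).
have E j : sharp G (cobase j) 0 k = invmx G j k.
  rewrite /sharp mxE (bigD1 j)//= !mxE !eqxx mul1r big1 ?addr0// => l lj.
  by rewrite !mxE (negPf lj) andbF mul0r.
under eq_bigr do rewrite E.
by have := congr1 (fun M : 'M__ => M i k) (mulmxV Gunit); rewrite !mxE eq_sym.
Qed.

Lemma comp_act_metric B al :
  comp_act (dfwedge (bilform G) B) al = \sum_i eps i (comp_act B (ins i al)).
Proof.
rewrite dfwedge_bilform comp_act_sum; apply: eq_bigr => i _.
rewrite comp_act_sum -sum_metric_sharp (lin_sum (comp_act_linear B)) linear_sum.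
apply: eq_bigr => j _ /=.
by rewrite comp_actZ comp_act_eps (linZ (comp_act_linear B)) covwedgeZ.
Qed.

(** The second hypothesis is Euler's identity for T, which holds when T is a
    combination of products of r exterior multiplications and r insertions.  The
    successive factors g of the power then contribute 1, 2, ..., d. *)
Lemma comp_act_gpow r A (T : eform R n -> eform R n) :
  (forall al, homogeneous r al -> comp_act A al = T al) ->
  (forall d al, homogeneous (d.+1 + r) al ->
     \sum_i eps i (T (ins i al)) = d.+1%:R *: T al) ->
  forall d al, homogeneous (d + r) al ->
    comp_act (dfwedge (dfpow (bilform G) d) A) al = d`!%:R *: T al.
Proof.
move=> AT TE; elim=> [|d IH] al hal.
  by rewrite dfwedge_one AT// scale1r.
rewrite /dfpow iterS -/(dfpow _ d) dfwedge_bilformA comp_act_metric.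
under eq_bigr do rewrite (IH _ (homogeneous_ins hal)) covwedgeZ.
by rewrite -scaler_sumr (TE d)// scalerA -natrM mulnC -factS.
Qed.

Lemma comp_act_gpow_term p r A (T : eform R n -> eform R n) :
  (forall al, homogeneous r al -> comp_act A al = T al) ->
  (forall d al, homogeneous (d.+1 + r) al ->
     \sum_i eps i (T (ins i al)) = d.+1%:R *: T al) ->
  ((p < r)%N -> forall al, homogeneous p al -> T al = 0) ->
  forall al, homogeneous p al -> comp_act (gpow_term G p r A) al = T al.
Proof.
move=> AT TE T0 al hal; rewrite /gpow_term; case: leqP => [rp|pr]; last first.
  by rewrite T0// -(scale0r (0 : dform R n)) comp_actZ scale0r.
rewrite comp_actZ (comp_act_gpow AT TE) ?subnK// scalerA mulVf ?scale1r//.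
by rewrite pnatr_eq0 -lt0n fact_gt0.
Qed.

Lemma homogeneous0E al : homogeneous 0 al -> al = al set0 *: one.
Proof.
move=> hal; apply/ffunP => I; rewrite !ffunE /GRing.scale /=.
case: eqVneq => [->|I0]; first by rewrite mulr1.
rewrite mulr0; apply/eqP; apply: contraNT I0 => /hal/eqP.
by rewrite cards_eq0.
Qed.

Lemma einner_one al : einner G al one = al set0.
Proof.
move: al; apply: eform_ind => [c x y hx hy||i I _ _].
- by rewrite einner_linearl hx hy !ffunE.
- by rewrite einner1.
- by rewrite einner_epsl ins_one einner0r eps_set0.
Qed.

(** Moving eps i and ins i inwards past the two factors of T costs two signs, and
    Euler's identity applies to the inner insertion. *)
Lemma comp_act_ric p (H : 'M[R]_n) al : homogeneous p al ->
  comp_act (gpow_term G p 1 (bilform H)) al =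
  \sum_j \sum_k H j k *: eps j (insG k al).
Proof.
move: al; apply: comp_act_gpow_term => [al hal|d al|/[!ltnS] + al hal].
- rewrite comp_act_sum; apply: eq_bigr => j _.
  rewrite comp_act_sum; apply: eq_bigr => k _.
  rewrite comp_actZ comp_act_tens !ebase1 (einner_epsr Gsym) einner_one.
  rewrite -covwedgeZ -homogeneous0E//; exact: homogeneous_ins.
- rewrite addn1 => hal.
  under eq_bigr do rewrite linear_sum; rewrite exchange_big scaler_sumr.
  apply: eq_bigr => j _ /=.
  under eq_bigr do rewrite linear_sum; rewrite exchange_big scaler_sumr.
  apply: eq_bigr => k _ /=.
  under eq_bigr do rewrite covwedgeZ eps_eps insertion_insertion
    !(linearN (covwedge _)) opprK.
  rewrite -scaler_sumr -linear_sum /= (euler (homogeneous_ins hal)) covwedgeZ.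
  by rewrite !scalerA mulrC.
- rewrite leqn0 => /eqP p0; rewrite p0 in hal.
  rewrite big1// => j _; rewrite big1// => k _.
  by rewrite homogeneous_ins0// linear0 scaler0.
Qed.

(** As for comp_act_ric, with four signs. *)
Lemma comp_act_riem p (S : 'I_n -> 'I_n -> 'I_n -> 'I_n -> R) al :
  homogeneous p al ->
  comp_act (gpow_term G p 2
    (\sum_(ij : 'I_n * 'I_n | (ij.1 < ij.2)%N)
     \sum_(kl : 'I_n * 'I_n | (kl.1 < kl.2)%N)
      S ij.1 ij.2 kl.1 kl.2 *:
        tens (ebase R [set ij.1; ij.2]) (ebase R [set kl.1; kl.2]))) al =
  \sum_(ij : 'I_n * 'I_n | (ij.1 < ij.2)%N)
  \sum_(kl : 'I_n * 'I_n | (kl.1 < kl.2)%N)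
    S ij.1 ij.2 kl.1 kl.2 *: eps ij.1 (eps ij.2 (insG kl.2 (insG kl.1 al))).
Proof.
have sumC (I : finType) (P : pred I) (F : I -> dform R n) x :
    comp_act (\sum_(i | P i) F i) x = \sum_(i | P i) comp_act (F i) x.
  rewrite big_mkcond comp_act_sum [RHS]big_mkcond; apply: eq_bigr => i _.
  by case: ifP => // _; rewrite -(scale0r (0 : dform R n)) comp_actZ scale0r.
move: al; apply: comp_act_gpow_term => [al hal|d al|p1 al hal].
- rewrite sumC; apply: eq_bigr => -[i j] /= ij.
  rewrite sumC; apply: eq_bigr => -[k l] /= kl.
  rewrite comp_actZ comp_act_tens !ebase2// !(einner_epsr Gsym) einner_one.
  rewrite -!covwedgeZ -homogeneous0E//.
  exact: (homogeneous_ins (homogeneous_ins hal)).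
- rewrite addn2 => hal.
  under eq_bigr do rewrite linear_sum; rewrite exchange_big scaler_sumr.
  apply: eq_bigr => -[i j] /= _.
  under eq_bigr do rewrite linear_sum; rewrite exchange_big scaler_sumr.
  apply: eq_bigr => -[k l] /= _.
  under eq_bigr => a _.
    rewrite covwedgeZ (eps_eps a i) (eps_eps a j) (insertion_insertion _ (cobase a)).
    rewrite (linearN (insertion _)) /= (insertion_insertion _ (cobase a)).
    rewrite !(linearN (covwedge _)) !opprK.
    over.
  rewrite /= -scaler_sumr -linear_sum /= -linear_sum /=.
  rewrite (euler (homogeneous_ins (homogeneous_ins hal))) !covwedgeZ.
  by rewrite !scalerA mulrC.
- rewrite big1// => -[i j] _; rewrite big1// => -[k l] _ /=.
  suff -> : insG l (insG k al) = 0 by rewrite !linear0.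
  case: p p1 hal => [|[|//]] _ hal; first by rewrite (homogeneous_ins0 _ hal) linear0.
  by rewrite homogeneous_ins0//; exact: homogeneous_ins.
Qed.
End Composition.

(** * Clifford commutators with a bivector *)

Section CliffordCommutator.
Variables (R : realType) (n : nat) (G : 'M[R]_n).
Hypothesis Gsym : G^T = G.
Implicit Types (al be : eform R n) (i j : 'I_n) (a b : 'rV[R]_n).
Local Notation eps i := (covwedge (cobase i)).
Local Notation insG i := (insertion (sharp G (cobase i))).
Local Notation one := (ebase R set0 : eform R n).
Local Notation "x ** y" := (clifford G x y) (at level 40).

Let cliffP := cliffordP Gsym.

Lemma clifford_linearl be : linear (fun x => x ** be).
Proof. by move=> c x y; exact: (cliffDl cliffP). Qed.

Lemma clifford_linearr al : linear (fun x => al ** x).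
Proof. by move=> c x y; exact: (cliffDr cliffP). Qed.

Lemma parityK al : parity (parity al) = al.
Proof. by apply/ffunP => I; rewrite !ffunE mulrA -expr2 sqrr_sign mul1r. Qed.

(** The defining property of the Clifford product is stated on homogeneous
    forms; rcov carries the sign by the parity operator. *)
Lemma clifford_covr al b : al ** covector b = rcov G b al.
Proof.
rewrite (linear_ebase al (clifford_linearl (covector b))).
rewrite [RHS](linear_ebase al (rcov_linear G b)); apply: eq_bigr => I _.
have hI := @homogeneous_base R n I.
rewrite (cliff_covr cliffP b hI) /rcov (parity_homogeneous hI).
by rewrite covwedgeZ insertionZ -scalerDr.
Qed.

Lemma clifford_biv_l a b be : (covector a ** covector b) ** be =
  covwedge a (covwedge b be - insertion (sharp G b) be)
  - insertion (sharp G a) (covwedge b be - insertion (sharp G b) be).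
Proof. by rewrite -(cliffA cliffP) !(cliff_covl cliffP). Qed.

Lemma clifford_biv_r a b be : be ** (covector a ** covector b) =
  - (covwedge b (covwedge a be + insertion (sharp G a) be)
     + insertion (sharp G b) (covwedge a be + insertion (sharp G a) be)).
Proof.
rewrite (cliffA cliffP) !clifford_covr /rcov.
have pD (x y : eform R n) : parity (x + y) = parity x + parity y.
  by have := @parity_linear R n 1 x y; rewrite !scale1r.
rewrite pD parity_cov parity_ins parityK -opprD.
by rewrite (linearN (covwedge _)) (linearN (insertion _)) -opprD.
Qed.

(** The terms with two exterior multiplications or two insertions agree for left
    and right multiplication, so that only the mixed terms remain. *)
Lemma ecomm_biv_cov a b be :
  (covector a ** covector b) ** be - be ** (covector a ** covector b) =
  2 *: (covwedge b (insertion (sharp G a) be) - covwedge a (insertion (sharp G b) be)).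
Proof.
rewrite clifford_biv_l clifford_biv_r.
rewrite !(linearB (covwedge _)) !(linearB (insertion _)) /=.
rewrite !(linearD (covwedge _)) !(linearD (insertion _)) /= !insertion_covwedge.
rewrite (covwedge_covwedge b) (insertion_insertion (sharp G b)).
rewrite -/(ip G a b) -/(ip G b a) (ipC Gsym b a).
move: (covwedge a (covwedge b be)) (insertion (sharp G a) (insertion _ be)) => x y.
move: (covwedge b (insertion _ be)) (covwedge a (insertion _ be)) => z t.
by apply/ffunP => I; rewrite !ffunE /GRing.scale /=; ring.
Qed.

(** Antisymmetrizing removes the scalar part of the Clifford product. *)
Lemma ebase2_clifford i j : (i < j)%N -> ebase R [set i; j] =
  2^-1 *: (covector (cobase i) ** covector (cobase j)
           - covector (cobase j) ** covector (cobase i)).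
Proof.
move=> ij; rewrite ebase2// !(cliff_covl cliffP) -!covwedge1.
rewrite !insertion_covwedge !ins_one !(linear0 (covwedge _)) !subr0 -!/(ip G _ _).
rewrite (ipC Gsym (cobase j)) (eps_eps j i).
by apply/ffunP => I; rewrite !ffunE /GRing.scale /=; field.
Qed.

(** The bivector dx^i /\ dx^j acts as an infinitesimal rotation. *)
Lemma ecomm_ebase2 i j be : (i < j)%N ->
  ecomm G (ebase R [set i; j]) be = 2 *: (eps j (insG i be) - eps i (insG j be)).
Proof.
move=> ij; rewrite /ecomm ebase2_clifford//.
rewrite (linZ (clifford_linearl be)) (linB (clifford_linearl be)).
rewrite (linZ (clifford_linearr be)) (linB (clifford_linearr be)).
set x := covector _ ** covector _; set y := covector _ ** covector _.
transitivity (2^-1 *: ((x ** be - be ** x) - (y ** be - be ** y))).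
  by apply/ffunP => I; rewrite !ffunE /GRing.scale /=; ring.
rewrite !ecomm_biv_cov -scalerBr scalerA mulVf ?pnatr_eq0// scale1r.
by apply/ffunP => I; rewrite !ffunE /GRing.scale /=; ring.
Qed.
End CliffordCommutator.

(** * Algebraic curvature tensors *)

(** Passes between sums over increasing pairs of indices, in which basis
    bivectors are listed, and full sums. *)
Lemma sum_pairs_lt n (V : nmodType) (H : 'I_n -> 'I_n -> V) :
  (forall i, H i i = 0) ->
  \sum_i \sum_j H i j =
  \sum_(p : 'I_n * 'I_n | (p.1 < p.2)%N) (H p.1 p.2 + H p.2 p.1).
Proof.
move=> H0; rewrite pair_bigA big_split /= (bigID (fun p : 'I_n * 'I_n => p.1 < p.2)%N) /=.
pose swap (p : 'I_n * 'I_n) := (p.2, p.1).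
have swapK : involutive swap by case.
congr (_ + _); rewrite [RHS](reindex_inj (inv_inj swapK)) /=.
rewrite (bigID (fun p : 'I_n * 'I_n => p.2 < p.1)%N) /= [X in _ + X]big1 ?addr0.
  by apply: eq_bigl => -[i j] /=; case: ltngtP.
by move=> -[i j] /=; case: ltngtP => // /val_inj -> _; exact: H0.
Qed.

Section CurvatureAlgebra.
Variables (R : realType) (n : nat) (G : 'M[R]_n).
Variable S : 'I_n -> 'I_n -> 'I_n -> 'I_n -> R.
Hypothesis Gsym : G^T = G.
Hypothesis S_antil : forall i j k l, S j i k l = - S i j k l.
Hypothesis S_antir : forall i j k l, S i j l k = - S i j k l.
Hypothesis S_pair : forall i j k l, S k l i j = S i j k l.
Hypothesis S_bianchi : forall i j k l, S i j k l + S j k i l + S k i j l = 0.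
Implicit Types (al be : eform R n) (i j k l a b : 'I_n) (A : dform R n).
Local Notation eps i := (covwedge (cobase i)).
Local Notation insG i := (insertion (sharp G (cobase i))).

Definition elemG i j al : eform R n := eps i (insG j al).

Definition curv_tensor : dform R n :=
  \sum_(ij : 'I_n * 'I_n | (ij.1 < ij.2)%N)
  \sum_(kl : 'I_n * 'I_n | (kl.1 < kl.2)%N)
    S ij.1 ij.2 kl.1 kl.2 *:
      tens (ebase R [set ij.1; ij.2]) (ebase R [set kl.1; kl.2]).

Lemma elemG_linear i j : linear (elemG i j).
Proof. by move=> c x y; rewrite /elemG !linearP. Qed.

Lemma S_diagl i k l : S i i k l = 0.
Proof. by have := S_antil i i k l; lra. Qed.

Lemma S_diagr i j k : S i j k k = 0.
Proof. by have := S_antir i j k k; lra. Qed.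

Lemma ecomm_linear al : linear (ecomm G al).
Proof.
move=> c x y; rewrite /ecomm (clifford_linearl Gsym) (clifford_linearr Gsym).
by rewrite scalerBr opprD addrACA.
Qed.

Lemma dfsharp_dbase s A : dfsharp G (dbase R s) A =
  on_left (ecomm G (ebase R s.1)) (on_right (ecomm G (ebase R s.2)) A).
Proof.
have el := ecomm_linear.
move: A; apply: eq_dform_linear => [c x y|c x y|t].
- exact: bilin_ext_linearr.
- by rewrite !linearP.
- by rewrite [LHS]bilin_ext_dbase /dbase on_right_tens// on_left_tens.
Qed.

(** The restriction to increasing pairs is absorbed by the antisymmetry of S
    and of the infinitesimal rotations; the factor 4 is 2 for each side. *)
Lemma dfsharp_curv A : dfsharp G curv_tensor A =
  4 *: \sum_i \sum_j \sum_k \sum_l S i j k l *: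
    on_left (elemG i j) (on_right (elemG k l) A).
Proof.
have el := elemG_linear.
have hL i j B : (i < j)%N -> on_left (ecomm G (ebase R [set i; j])) B =
    2 *: (on_left (elemG j i) B - on_left (elemG i j) B).
  move=> ij; rewrite (eq_on_left (fun al => ecomm_ebase2 Gsym al ij)).
  by rewrite on_leftZ on_leftB.
have hR i j B : (i < j)%N -> on_right (ecomm G (ebase R [set i; j])) B =
    2 *: (on_right (elemG j i) B - on_right (elemG i j) B).
  move=> ij; rewrite (eq_on_right (fun al => ecomm_ebase2 Gsym al ij)).
  by rewrite on_rightZ on_rightB.
have dl := bilin_ext_linearl (fun x1 x2 y1 y2 => tens (ecomm G x1 y1) (ecomm G x2 y2)) A.
rewrite sum_pairs_lt => [|i]; last first.
  by rewrite big1// => k _; rewrite big1// => l _; rewrite S_diagl scale0r.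
rewrite scaler_sumr /curv_tensor [LHS](dlin_sum dl); apply: eq_bigr => -[i j] /= ij.
do 2![rewrite [in RHS]sum_pairs_lt => [|k]; last by rewrite S_diagr scale0r].
rewrite -big_split scaler_sumr [LHS](dlin_sum dl); apply: eq_bigr => -[k l] /= kl.
rewrite [LHS](dlinZ dl) [X in _ *: X](dfsharp_dbase ([set i; j], [set k; l])) /=.
rewrite hR// hL// !(linearZ_LR (on_left _)) !(linearB (on_left _)) /=.
rewrite (S_antil i j) (S_antir i j k l) (S_antir j i k l) (S_antil i j).
have alg (c : R) (x y z t : dform R n) :
    c *: (2 *: (2 *: (x - y) - 2 *: (z - t))) =
    4 *: (c *: t + (- c) *: z + ((- c) *: y + - - c *: x)).
  by apply/ffunP => s; rewrite !ffunE /GRing.scale /=; ring.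
exact: alg.
Qed.

Lemma tensor_act_full al :
  4 *: (\sum_(ij : 'I_n * 'I_n | (ij.1 < ij.2)%N)
  \sum_(kl : 'I_n * 'I_n | (kl.1 < kl.2)%N)
    S ij.1 ij.2 kl.1 kl.2 *: eps ij.1 (eps ij.2 (insG kl.2 (insG kl.1 al)))) =
  \sum_i \sum_j \sum_k \sum_l S i j k l *: eps i (eps j (insG l (insG k al))).
Proof.
rewrite sum_pairs_lt => [|i]; last first.
  by rewrite big1// => k _; rewrite big1// => l _; rewrite S_diagl scale0r.
rewrite scaler_sumr; apply: eq_bigr => -[i j] /= ij.
do 2![rewrite sum_pairs_lt => [|k]; last by rewrite S_diagr scale0r].
rewrite -big_split scaler_sumr; apply: eq_bigr => -[k l] /= kl.
rewrite (S_antil i j) (S_antir i j k l) (S_antir j i k l) (S_antil i j).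
rewrite (insertion_insertion _ (sharp G (cobase l))) !(linearN (covwedge _)) /=.
rewrite (eps_eps j i); move: (eps i (eps j _)) => x.
by apply/ffunP => s; rewrite !ffunE /GRing.scale /=; ring.
Qed.

(** Ricci contraction of S for the inverse metric ip G. *)
Definition ricci : 'M[R]_n :=
  \matrix_(i, j) \sum_k \sum_l S i k j l * ip G (cobase k) (cobase l).

(** Reordering e_k i_l e_a i_b gives the Ricci term and a term with two e's and
    two i's.  The latter sees only the part of S k l b a antisymmetric in k and a,
    and S k l b a - S a l b k = S k a b l by the Bianchi identity and the pair
    symmetry. *)
Lemma weitzenboeck_left al :
  \sum_k \sum_l \sum_a \sum_b S k l b a *: elemG k l (elemG a b al) =
  \sum_k \sum_b ricci k b *: eps k (insG b al)
  - 2 *: \sum_(ij : 'I_n * 'I_n | (ij.1 < ij.2)%N)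
     \sum_(kl : 'I_n * 'I_n | (kl.1 < kl.2)%N)
    S ij.1 ij.2 kl.1 kl.2 *: eps ij.1 (eps ij.2 (insG kl.2 (insG kl.1 al))).
Proof.
pose Z k a l b := eps k (eps a (insG l (insG b al))).
have E k l a b : elemG k l (elemG a b al) =
    ip G (cobase l) (cobase a) *: eps k (insG b al) - Z k a l b.
  by rewrite /elemG insertion_covwedge linearB linearZ.
transitivity (\sum_k \sum_b ricci k b *: eps k (insG b al)
    - \sum_k \sum_a \sum_l \sum_b S k l b a *: Z k a l b).
  rewrite -sumrB; apply: eq_bigr => k _.
  have -> : \sum_b ricci k b *: eps k (insG b al) = \sum_l \sum_a \sum_b
      (S k l b a * ip G (cobase l) (cobase a)) *: eps k (insG b al).
    under [RHS]eq_bigr do rewrite exchange_big /=.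
    rewrite [RHS]exchange_big /=; apply: eq_bigr => b _.
    by rewrite mxE scaler_suml; apply: eq_bigr => l _; rewrite scaler_suml.
  rewrite [X in _ - X]exchange_big -sumrB; apply: eq_bigr => l _ /=.
  rewrite -sumrB; apply: eq_bigr => a _; rewrite -sumrB; apply: eq_bigr => b _.
  by rewrite E scalerBr scalerA.
congr (_ - _); apply: (@scalerI _ _ (2 : R)); first by rewrite pnatr_eq0.
rewrite scalerA -natrM tensor_act_full scaler_nat mulr2n.
(* twice the sum is the sum antisymmetrized in k and a *)
rewrite {2}exchange_big /= -big_split; apply: eq_bigr => k _.
rewrite -big_split; apply: eq_bigr => a _ /=.
rewrite -big_split [RHS]exchange_big; apply: eq_bigr => l _ /=.
rewrite -big_split; apply: eq_bigr => b _ /=.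
rewrite /Z (eps_eps a k) scalerN -scalerBl; congr (_ *: _).
have := S_bianchi k l b a.
by rewrite (S_pair b k a l) (S_antir b k l a) (S_pair k a l b) (S_antir k a b l); lra.
Qed.
End CurvatureAlgebra.

(** * The Weitzenboeck curvature term *)

Lemma exchange_big4 (I : finType) (V : nmodType) (F : I -> I -> I -> I -> V) :
  \sum_i \sum_j \sum_k \sum_l F i j k l = \sum_k \sum_l \sum_i \sum_j F i j k l.
Proof.
under eq_bigr do rewrite exchange_big /=.
rewrite exchange_big; apply: eq_bigr => k _ /=.
under eq_bigr do rewrite exchange_big /=.
by rewrite exchange_big.
Qed.

Section OrthonormalFrame.
Variables (R : realType) (n : nat) (G e : 'M[R]_n).
Hypothesis ortho : e *m G *m e^T = 1%:M.
Implicit Types (A : dform R n) (al : eform R n).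
Local Notation eps i := (covwedge (cobase i)).
Local Notation insG i := (insertion (sharp G (cobase i))).

Lemma insertion_sum_vec (I : finType) (c : I -> R) (v : I -> 'rV[R]_n) al :
  insertion (\sum_i c i *: v i) al = \sum_i c i *: insertion (v i) al.
Proof.
rewrite insertionE.
under [RHS]eq_bigr do rewrite insertionE scaler_sumr.
rewrite exchange_big; apply: eq_bigr => j _ /=.
under [RHS]eq_bigr do rewrite scalerA; rewrite -scaler_suml; congr (_ *: _).
by rewrite summxE; apply: eq_bigr => i _; rewrite mxE.
Qed.

Lemma covwedge_sum_vec (I : finType) (c : I -> R) (v : I -> 'rV[R]_n) al :
  covwedge (\sum_i c i *: v i) al = \sum_i c i *: covwedge (v i) al.
Proof.
rewrite covwedgeE.
under [RHS]eq_bigr do rewrite covwedgeE scaler_sumr.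
rewrite exchange_big; apply: eq_bigr => j _ /=.
under [RHS]eq_bigr do rewrite scalerA; rewrite -scaler_suml; congr (_ *: _).
by rewrite summxE; apply: eq_bigr => i _; rewrite mxE.
Qed.

(** An orthonormal frame also inverts the metric on the other side: e^T e is
    the inverse Gram matrix. *)
Lemma frame_gram : e^T *m (e *m G) = 1%:M.
Proof. exact: mulmx1C. Qed.

Lemma frame_sum k : \sum_i e i k *: row i e = row k (e^T *m e).
Proof.
rewrite row_mul mulmx_sum_row; apply: eq_bigr => i _.
by rewrite !mxE.
Qed.

Lemma frame_sharp l al : \sum_i e i l *: insertion (row i e) al = insG l al.
Proof.
rewrite -insertion_sum_vec frame_sum /sharp -rowE; congr (insertion (row l _) al).
have Gu : G \in unitmx.
  by have [] := mulmx1_unit (etrans (esym (mulmxA _ _ _)) frame_gram).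
by rewrite -[LHS](mulmxK Gu) -(mulmxA e^T) frame_gram mul1mx.
Qed.

Lemma frame_flat k al : \sum_j e j k *: covwedge (flat G (row j e)) al = eps k al.
Proof.
rewrite -covwedge_sum_vec; congr (covwedge _ al).
rewrite /flat; under eq_bigr do rewrite scalemxAl.
by rewrite -mulmx_suml frame_sum -row_mul -mulmxA frame_gram row1.
Qed.

(** With coordinate components as coefficients, the sum of frame vectors is a
    dual vector and the sum of dual covectors is a coordinate covector. *)
Lemma frame_contraction k l A :
  \sum_i \sum_j on_left (insertion (row i e))
     (on_left (covwedge (flat G (row j e))) ((e j k * e i l) *: A)) =
  on_left (insG l) (on_left (eps k) A).
Proof.
rewrite -(eq_on_left (frame_sharp l)) on_left_sum; apply: eq_bigr => i _.
rewrite on_leftZ -(eq_on_left (frame_flat k)) on_left_sum.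
rewrite (linear_sum (on_left _)) /= scaler_sumr.
apply: eq_bigr => j _; rewrite on_leftZ !(linearZ_LR (on_left _)) /=.
by rewrite scalerA mulrC.
Qed.
End OrthonormalFrame.

Section Weitzenboeck.
Variables (R : realType) (n : nat) (U : set 'rV[R]_n) (G : 'rV[R]_n -> 'M[R]_n).
Hypothesis Uopen : open U.
Hypothesis Gsmooth : forall i j, smooth_on U (fun y => G y i j).
Hypothesis Gsym : forall y, U y -> (G y)^T = G y.
Hypothesis Gunit : forall y, U y -> G y \in unitmx.
Variable om : 'rV[R]_n -> dform R n.
Hypothesis om_smooth : forall s, smooth_on U (fun y => om y s).
Variables (y : 'rV[R]_n) (Uy : U y).
Implicit Types (i j k l m a b : 'I_n).
Local Notation eps i := (covwedge (cobase i)).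
Local Notation insG i := (insertion (sharp (G y) (cobase i))).
Local Notation S i j k l := (riem4 G i j k l y).
Local Notation E i j := (elemG (G y) i j).

Let S_antil i j k l : S j i k l = - S i j k l.
Proof. exact: riem4_antil. Qed.
Let S_antir i j k l : S i j l k = - S i j k l.
Proof. exact: (riem4_antir Uopen Gsmooth Gsym Gunit). Qed.
Let S_pair i j k l : S k l i j = S i j k l.
Proof. exact: (riem4_pair Uopen Gsmooth Gsym Gunit). Qed.
Let S_bianchi i j k l : S i j k l + S j k i l + S k i j l = 0.
Proof. exact: (riem4_bianchi Uopen Gsmooth Gsym Gunit). Qed.

Lemma sharp_cobase i j : sharp (G y) (cobase i) 0 j = invmx (G y) i j.
Proof. by rewrite /sharp -rowE mxE. Qed.

Lemma riem_raise m l i j : riem G m l i j y = \sum_k invmx (G y) m k * S i j k l.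
Proof.
under [RHS]eq_bigr do rewrite /riem4 mulr_sumr.
rewrite exchange_big /=.
have E a : \sum_k invmx (G y) m k * (G y k a * riem G a l i j y) =
    (m == a)%:R * riem G a l i j y.
  under eq_bigr do rewrite mulrA; rewrite -mulr_suml; congr (_ * _).
  by have := congr1 (fun M : 'M__ => M m a) (mulVmx (Gunit Uy)); rewrite !mxE.
under eq_bigr do rewrite E; rewrite (bigD1 m)//= eqxx mul1r big1 ?addr0//.
by move=> a am; rewrite eq_sym (negPf am) mul0r.
Qed.

(** The two antisymmetries of the curvature tensor reconcile the index orders of
    the two contractions. *)
Lemma Ric_ricci : Ric G y = bilform (ricci (G y) (fun i j k l => S i j k l)).
Proof.
rewrite /Ric; congr (bilform _); apply/matrixP => k b; rewrite !mxE.
apply: eq_bigr => m _; rewrite riem_raise; apply: eq_bigr => a _.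
by rewrite ip_cobase sharp_cobase (S_antil k m) (S_antir k m b a) opprK mulrC.
Qed.

(** Minus the curvature R(d_k, d_l) applied to om at y; the raised index of riem
    is absorbed into the dual vectors (curv_formE). *)
Definition curv_form k l : dform R n :=
  \sum_a \sum_b S k l b a *: (on_left (E a b) (om y) + on_right (E a b) (om y)).

Lemma curv_formC k l : curv_form l k = - curv_form k l.
Proof.
rewrite /curv_form -sumrN; apply: eq_bigr => a _; rewrite -sumrN.
by apply: eq_bigr => b _; rewrite S_antil scaleNr.
Qed.

Lemma curv_formE k l :
  \sum_a \sum_m riem G m a k l y *: delem a m (om y) = curv_form k l.
Proof.
apply: eq_bigr => a _.
have E m : delem a m (om y) =
    \sum_b G y m b *: (on_left (E a b) (om y) + on_right (E a b) (om y)).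
  rewrite /delem.
  have el al : elem a m al = \sum_b G y m b *: E a b al.
    rewrite /elem -(sum_metric_sharp (Gunit Uy)) linear_sum.
    by apply: eq_bigr => b _; rewrite /= covwedgeZ.
  rewrite (eq_on_left el) (eq_on_right el) on_left_sum on_right_sum -big_split.
  by apply: eq_bigr => b _ /=; rewrite on_leftZ on_rightZ scalerDr.
under eq_bigr do rewrite E scaler_sumr; rewrite exchange_big /=.
apply: eq_bigr => b _; rewrite /riem4 scaler_suml; apply: eq_bigr => m _.
by rewrite scalerA (metricC Gsym b m Uy) mulrC.
Qed.

(** Exchanging the insertion and the exterior multiplication produces the trace
    of the curvature over its antisymmetric pair, which vanishes. *)
Lemma WeitE e : orthonormal_at G y e -> Weit G e om y =
  \sum_k \sum_l on_left (E k l) (curv_form k l).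
Proof.
move=> ortho.
have -> : Weit G e om y =
    - \sum_k \sum_l on_left (insG l) (on_left (eps k) (curv_form k l)).
  under [in RHS]eq_bigr do under eq_bigr do rewrite -(frame_contraction ortho).
  rewrite /Weit.
  transitivity (- \sum_i \sum_j \sum_k \sum_l on_left (insertion (row i e))
     (on_left (covwedge (flat (G y) (row j e))) ((e j k * e i l) *: curv_form k l))).
    rewrite -sumrN; apply: eq_bigr => i _; rewrite -sumrN; apply: eq_bigr => j _.
    rewrite dfwedge_covl (curv_opE Uopen Gsmooth Gsym Gunit om_smooth _ _ Uy).
    rewrite !(linearN (on_left _)) /=; congr (- _).
    have fl : linear (fun A => on_left (insertion (row i e))
        (on_left (covwedge (flat (G y) (row j e))) A)).
      by move=> t A B; rewrite !linearP.
    rewrite [LHS](dlin_sum fl); apply: eq_bigr => k _.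
    rewrite [LHS](dlin_sum fl); apply: eq_bigr => l _.
    by rewrite curv_formE !mxE.
  exact: (congr1 -%R (exchange_big4 (fun i j k l => on_left (insertion (row i e))
    (on_left (covwedge (flat (G y) (row j e))) ((e j k * e i l) *: curv_form k l))))).
have swap k l A : on_left (insG l) (on_left (eps k) A) =
    ip (G y) (cobase l) (cobase k) *: A - on_left (E k l) A.
  rewrite on_left_comp; last exact: insertion_linear.
  rewrite -[X in _ *: X]on_left_id -on_leftZ -on_leftB.
  by apply: eq_on_left => al /=; rewrite insertion_covwedge.
(* the trace of an antisymmetric tensor against the symmetric inverse metric *)
have trace0 : \sum_k \sum_l ip (G y) (cobase l) (cobase k) *: curv_form k l = 0.
  set X := LHS; have XN : X = - X.
    rewrite {1}/X exchange_big -sumrN; apply: eq_bigr => k _; rewrite -sumrN.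
    by apply: eq_bigr => l _; rewrite curv_formC scalerN (ipC (Gsym Uy)).
  apply: (@scalerI _ _ (2 : R)); first by rewrite pnatr_eq0.
  by rewrite scaler0 scaler_nat mulr2n {1}XN addNr.
under eq_bigr do under eq_bigr do rewrite swap.
under eq_bigr do rewrite sumrB.
by rewrite sumrB trace0 sub0r opprK.
Qed.

(** The left-left part of WeitE matches the composition by weitzenboeck_left,
    the left-right part matches the sharp product. *)
Lemma weitzenboeck p q e : orthonormal_at G y e -> bihomogeneous p q (om y) ->
  Weit G e om y =
    dfcomp (G y) (om y)
      (gpow_term (G y) p 1 (Ric G y) - 2 *: gpow_term (G y) p 2 (Riem G y))
    - 4^-1 *: dfsharp (G y) (Riem G y) (om y).
Proof.
move=> ortho hom; rewrite WeitE//.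
have RiemE : Riem G y = curv_tensor (fun i j k l => S i j k l) by [].
rewrite RiemE (dfsharp_curv (Gsym Uy) S_antil S_antir).
rewrite scalerA mulVf ?pnatr_eq0// scale1r dfcompE.
have split_curv k l : on_left (E k l) (curv_form k l) =
    \sum_a \sum_b S k l b a *: on_left (E k l) (on_left (E a b) (om y))
    - \sum_a \sum_b S k l a b *: on_left (E k l) (on_right (E a b) (om y)).
  rewrite -sumrB [LHS](dlin_sum (on_left_is_linear _)); apply: eq_bigr => a _.
  rewrite -sumrB [LHS](dlin_sum (on_left_is_linear _)); apply: eq_bigr => b _.
  rewrite [LHS](dlinZ (on_left_is_linear _)) (linearD (on_left _)) /= scalerDr.
  by rewrite [in X in _ + X](S_antir k l a b) scaleNr.
under eq_bigr do under eq_bigr do rewrite split_curv.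
under eq_bigr do rewrite sumrB; rewrite sumrB; congr (_ - _).
have -> : \sum_k \sum_l \sum_a \sum_b
    S k l b a *: on_left (E k l) (on_left (E a b) (om y)) =
    on_left (fun al => \sum_k \sum_l \sum_a \sum_b S k l b a *: E k l (E a b al)) (om y).
  rewrite on_left_sum; apply: eq_bigr => k _.
  rewrite on_left_sum; apply: eq_bigr => l _.
  rewrite on_left_sum; apply: eq_bigr => a _.
  rewrite on_left_sum; apply: eq_bigr => b _.
  by rewrite on_leftZ on_left_comp//; exact: elemG_linear.
apply: (eq_on_left_homog hom) => al hal.
rewrite (weitzenboeck_left (G y) S_antil S_antir S_pair S_bianchi).
have actB A B : comp_act (G y) (A - 2 *: B) al =
    comp_act (G y) A al - 2 *: comp_act (G y) B al.
  by rewrite addrC -scaleNr comp_act_linearl scaleNr addrC.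
rewrite actB Ric_ricci (comp_act_ric (Gsym Uy) (Gunit Uy) _ hal).
by rewrite (comp_act_riem (Gsym Uy) (Gunit Uy) _ hal).
Qed.
End Weitzenboeck.

Lemma posdef_unitmx (R : realType) n (A : 'M[R]_n) :
  (forall v : 'rV[R]_n, v != 0 -> 0 < (v *m A *m v^T) 0 0) -> A \in unitmx.
Proof.
move=> Apos; rewrite -row_free_unit -kermx_eq0; apply: contraT => kA.
move: kA; rewrite -nz_row_eq0 => /Apos.
have /sub_kermxP -> := nz_row_sub (kermx A).
by rewrite mul0mx mxE ltxx.
Qed.

Theorem proposition5p7 (R : realType) (n : nat) (M : manifold R n)
    (g : riemannian_metric M) (p q : nat) (omega : double_form M p q)
    (c : chart M) (x : M) (hx : chart_dom c x)
    (e : 'M[R]_n) (he : orthonormal_at (g c) (chart_map c x) e) :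
  let y := chart_map c x in
  let G := g c y in
  Weit (g c) e (omega c) y =
    dfcomp G (omega c y)
      (gpow_term G p 1 (Ric (g c) y) - 2 *: gpow_term G p 2 (Riem (g c) y))
    - 4^-1 *: dfsharp G (Riem (g c) y) (omega c y).
Proof.
have Uy : chart_img c (chart_map c x) by exists x.
apply: (@weitzenboeck R n (chart_img c) (g c) _ _ _ _ (omega c) _ _ Uy p q e he).
- exact: chart_img_open.
- exact: gmx_smooth.
- by move=> y; exact: gmx_sym.
- by move=> y Uy'; apply: posdef_unitmx => v v0; exact: gmx_pos.
- exact: dfc_smooth.
- exact: dfc_deg.
Qed.
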